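(* Let $X$ be a complex manifold equipped with a Kähler metric. Then the following commutation relations hold: 1. $[L,\partial]=[L,\bar\partial]=0$ and $[\Lambda,\partial^*]=[\Lambda,\bar\partial^*]=0$; 2. $[\Lambda,\bar\partial]=-\sqrt{-1}\,\partial^*$ and $[\Lambda,\partial]=\sqrt{-1}\,\bar\partial^*$; 3. $[\bar\partial^*,L]=\sqrt{-1}\,\partial$ and $[\partial^*,L]=-\sqrt{-1}\,\bar\partial$.
   Context: A Hermitian metric on a complex manifold $X$ with induced complex structure $J$ is a Riemannian metric $g$ with $g(Ju,Jv)=g(u,v)$; its fundamental form is $\omega=g(J\cdot,\cdot)$ (extended $\mathbb{C}$-bilinearly to the complexified tangent bundle), and $g$ is Kähler if $d\omega=0$. In $\mathbb{C}^n$ with the standard metric, $\omega=\frac{\sqrt{-1}}{2}\sum_k dz_k\wedge d\bar z_k$. All operators act on smooth complex-valued differential forms with compact support, and $[A,B]=AB-BA$. $L$ is the Lefschetz operator $L\alpha=\omega\wedge\alpha$. $*$ is the $\mathbb{C}$-linear extension of the Hodge star operator of $g$ (with the orientation induced by the complex structure), so that $\alpha\wedge\overline{*\beta}=(\alpha,\beta)\,\mathrm{vol}$, where $(\cdot,\cdot)$ is the pointwise Hermitian product on forms induced by $g$. $\Lambda=*^{-1}\circ L\circ *$ is the pointwise adjoint of $L$. Finally $d=\partial+\bar\partial$ is the decomposition by type, and $\partial^*=-*\circ\bar\partial\circ *$, $\bar\partial^*=-*\circ\partial\circ *$ (the formal $L^2$-adjoints of $\partial$ and $\bar\partial$). *)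

(* Defs.v *)
From HB Require Import structures.
From mathcomp Require Import all_boot all_order all_algebra.
From mathcomp Require Import complex.
From mathcomp Require Import all_classical all_reals all_analysis.

Set Implicit Arguments.
Unset Strict Implicit.
Unset Printing Implicit Defensive.

Import Order.TTheory GRing.Theory Num.Theory.
Import numFieldNormedType.Exports.

Local Open Scope classical_set_scope.
Local Open Scope ring_scope.
Local Open Scope complex_scope.

(** * Exterior algebra of the complexified cotangent space of C^n

C^n is identified with the space ['rV[R]_(n + n)] of real row vectors
(x_1, ..., x_n, y_1, ..., y_n), where z_k = x_k + i y_k; write
e_1, ..., e_2n for its standard basis and dx_1, ..., dx_2n for the dual basis
(so that dx_(n+k) = dy_k).  Linear maps act on row vectors on the right. *)

Definition xcoord n (k : 'I_n) : 'I_(n + n) := lshift n k.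
Definition ycoord n (k : 'I_n) : 'I_(n + n) := rshift n k.

Definition basis_vec (R : realType) m (k : 'I_m) : 'rV[R]_m := delta_mx 0 k.

(** Multiplication by the square root of -1: d/dx_k |-> d/dy_k |-> - d/dx_k. *)
Definition Jmx (R : realType) n : 'M[R]_(n + n) :=
  block_mx 0 1%:M (- 1%:M) 0.

(** A (possibly inhomogeneous) complex covector [a] stands for
    \sum_A a A * dx_A, where dx_A is the wedge product of the dx_k, k in A,
    taken in increasing order. *)
Definition covec (R : realType) n := {ffun {set 'I_(n + n)} -> R[i]}.

Definition scalecv (R : realType) n (c : R[i]) (a : covec R n) : covec R n :=
  [ffun A => c * a A].

Definition dxset (R : realType) n (A : {set 'I_(n + n)}) : covec R n :=
  [ffun B => (B == A)%:R].

Definition dx (R : realType) n (k : 'I_(n + n)) : covec R n := dxset R [set k].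

(** dx_A /\ dx_B = shuffle_sign A B * dx_(A :|: B) when A and B are disjoint. *)
Definition shuffle_sign (R : realType) m (A B : {set 'I_m}) : R[i] :=
  (-1) ^+ #|[pred p : 'I_m * 'I_m | [&& p.1 \in A, p.2 \in B & (p.2 < p.1)%N]]|.

Definition wedge (R : realType) n (a b : covec R n) : covec R n :=
  [ffun A : {set 'I_(n + n)} =>
     \sum_(B : {set 'I_(n + n)} | B \subset A)
        shuffle_sign R B (A :\: B) * a B * b (A :\: B)].

(** The minor of [P] with rows in [A] and columns in [B], both enumerated in
    increasing order; it is 0 by convention when the cardinals differ.  The
    default value of [nth] is irrelevant. *)
Definition minor (K : comNzRingType) m (P : 'M[K]_m) (A B : {set 'I_m}) : K :=
  if #|A| == #|B| then
    \det (\matrix_(i < #|A|, j < #|A|)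
            P (enum_val i) (nth (enum_val i) (enum B) j))
  else 0.

(** Pull-back by the linear map v |-> v *m P:
    dx_A is mapped to \sum_B minor P B A * dx_B. *)
Definition pullback (R : realType) n (P : 'M[R[i]]_(n + n)) (a : covec R n) :
    covec R n :=
  [ffun B : {set 'I_(n + n)} => \sum_(A : {set 'I_(n + n)}) a A * minor P B A].

(** ** Decomposition by type *)

(** The rows are the vectors d/dz_k = (d/dx_k - i d/dy_k) / 2, then the vectors
    d/dzbar_k = (d/dx_k + i d/dy_k) / 2.  Hence [pullback (Zframe R n) a] lists
    the coefficients of [a] in the basis made of the wedge products of the dz_k
    (indices [xcoord k]) and the dzbar_k (indices [ycoord k]). *)
Definition Zframe (R : realType) n : 'M[R[i]]_(n + n) :=
  2%:R^-1 *: block_mx 1%:M (- 'i%C)%:M 1%:M ('i%C)%:M.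

(** Projection onto the covectors of type (p, q), i.e. onto the span of the
    dz_I /\ dzbar_J with #|I| = p and #|J| = q. *)
Definition type_proj (R : realType) n (p q : nat) (a : covec R n) : covec R n :=
  let b := pullback (Zframe R n) a in
  pullback (invmx (Zframe R n))
    [ffun A : {set 'I_(n + n)} =>
       if (#|[pred k : 'I_n | xcoord k \in A]| == p)
          && (#|[pred k : 'I_n | ycoord k \in A]| == q)
       then b A else 0].

(** ** Linear algebra of a metric

A metric on the real vector space C^n is given by its Gram matrix [G] in the
standard basis. *)

Definition gprod (R : realType) n (G : 'M[R]_(n + n)) (u v : 'rV[R]_(n + n)) : R :=
  (u *m G *m v^T) 0 0.

(** \sum_(a < b) omega(e_a, e_b) dx_a /\ dx_b, where omega(u, v) = g(Ju, v). *)
Definition fundamental_form (R : realType) n (G : 'M[R]_(n + n)) : covec R n :=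
  \sum_(a < n + n) \sum_(b < n + n | (a < b)%N)
    scalecv (gprod G (basis_vec R a *m Jmx R n) (basis_vec R b))%:C
      (wedge (dx R a) (dx R b)).

(** Hermitian product on covectors: covectors of different degrees are
    orthogonal, and (dx_A, dx_B) is the determinant of the products (dx_a, dx_b)
    for a in A and b in B; the latter are the entries of the inverse of [G]. *)
Definition covec_prod (R : realType) n (G : 'M[R]_(n + n)) (a b : covec R n) : R[i] :=
  \sum_(A : {set 'I_(n + n)}) \sum_(B : {set 'I_(n + n)})
    a A * conjc (b B) * (minor (invmx G) A B)%:C.

(** Riemannian volume form, for the orientation of
    dx_1 /\ dy_1 /\ ... /\ dx_n /\ dy_n. *)
Definition vol (R : realType) n (G : 'M[R]_(n + n)) : covec R n :=
  scalecv (Num.sqrt (\det G))%:C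
    (\big[@wedge R n/dxset R finset.set0]_(k < n)
       wedge (dx R (xcoord k)) (dx R (ycoord k))).

Definition conjcv (R : realType) n (a : covec R n) : covec R n :=
  [ffun A => conjc (a A)].

(** The coefficients are read off from
    dx_A /\ conj (star b) = (dx_A, b) vol; see [starP] below. *)
Definition star (R : realType) n (G : 'M[R]_(n + n)) (b : covec R n) : covec R n :=
  [ffun B : {set 'I_(n + n)} =>
     shuffle_sign R (finset.setC B) B
     * conjc (covec_prod G (dxset R (finset.setC B)) b * vol G finset.setT)].

Definition homogeneous (R : realType) n (k : nat) (a : covec R n) :=
  forall A : {set 'I_(n + n)}, a A != 0 -> #|A| = k.

Lemma homogeneous_wedge (R : realType) n k l (a b : covec R n) :
  homogeneous k a -> homogeneous l b -> homogeneous (k + l) (wedge a b).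
Proof.
move=> ha hb A; rewrite ffunE; apply: contra_neqP => /eqP hA.
rewrite big1 // => B sBA.
have [->|/ha hB] := eqVneq (a B) 0; first by rewrite mulr0 mul0r.
have [->|/hb hC] := eqVneq (b (A :\: B)) 0; first by rewrite mulr0.
by case/eqP: hA; rewrite -(cardsID B A) (finset.setIidPr sBA) hB hC.
Qed.

Lemma homogeneous_vol (R : realType) n (G : 'M[R]_(n + n)) :
  homogeneous (n + n) (vol G).
Proof.
have hset (A : {set 'I_(n + n)}) : homogeneous #|A| (dxset R A).
  by move=> B; rewrite ffunE; case: (eqVneq B A) => [->|_] //; rewrite eqxx.
have hdx (k : 'I_(n + n)) : homogeneous 1 (dx R k).
  by rewrite -(cards1 k); exact: hset.
suff h : homogeneous (\sum_(k < n) 2)%N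
    (\big[@wedge R n/dxset R finset.set0]_(k < n)
       wedge (dx R (xcoord k)) (dx R (ycoord k))).
  move=> A; rewrite ffunE mulf_eq0 negb_or => /andP[_ /h ->].
  by rewrite sum_nat_const card_ord muln2 addnn.
apply: (big_ind2 (fun (a : covec R n) k => homogeneous k a)) => [|a k b l|k _].
- by rewrite -(cards0 'I_(n + n)); exact: hset.
- exact: homogeneous_wedge.
- exact: (homogeneous_wedge (hdx _) (hdx _)).
Qed.

(** The characterization of the (C-linear) Hodge star. *)
Lemma starP (R : realType) n (G : 'M[R]_(n + n)) k (a b : covec R n) :
  homogeneous k a -> homogeneous k b ->
  wedge a (conjcv (star G b)) = scalecv (covec_prod G a b) (vol G).
Proof.
move=> ha hb; apply/ffunP => A; rewrite [LHS]ffunE [RHS]ffunE.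
have prodE (C : {set 'I_(n + n)}) : covec_prod G (dxset R C) b =
    \sum_(B : {set 'I_(n + n)}) conjc (b B) * (minor (invmx G) C B)%:C.
  rewrite /covec_prod (bigD1 C) //= [X in _ + X]big1 ?addr0.
    by apply: eq_bigr => B _; rewrite ffunE eqxx mul1r.
  move=> B neB; rewrite big1 // => D _.
  by rewrite ffunE (negPf neB) !mul0r.
have conj_sign (B D : {set 'I_(n + n)}) :
    conjc (shuffle_sign R B D) = shuffle_sign R B D.
  by rewrite /shuffle_sign rmorphXn rmorphN1.
have [->|neA] := eqVneq A finset.setT.
  rewrite /covec_prod mulr_suml.
  rewrite (eq_bigl xpredT) => [|B]; last by rewrite finset.subsetT.
  apply: eq_bigr => B _.
  rewrite finset.setTD [conjcv _ _]ffunE [star _ _ _]ffunE finset.setCK rmorphM /= conj_sign conjcK.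
  rewrite prodE mulrACA -expr2.
  rewrite /shuffle_sign sqrr_sign mul1r mulrA; congr (_ * _).
  by rewrite mulr_sumr; apply: eq_bigr => D _; rewrite mulrA.
have -> : vol G A = 0.
  apply: contraNeq neA => /homogeneous_vol hA.
  by rewrite eqEcard finset.subsetT cardsT card_ord hA leqnn.
rewrite mulr0 big1 // => B sBA.
have [->|/ha hB] := eqVneq (a B) 0; first by rewrite mulr0 mul0r.
rewrite [conjcv _ _]ffunE [star _ _ _]ffunE prodE big1 ?mul0r ?rmorph0 ?mulr0 ?rmorph0 ?mulr0 // => D _.
have [->|/hb hD] := eqVneq (b D) 0; first by rewrite rmorph0 mul0r.
rewrite /minor; case: eqP => [hC|_]; last by rewrite rmorph0 mulr0.
case/negP: neA; rewrite eqEcard finset.subsetT cardsT card_ord /=.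
rewrite -(cardsID B A) (finset.setIidPr sBA) hB -hD -hC.
by rewrite addnC cardsC card_ord.
Qed.

(** The inverse of [star G], which is bijective when [G] is a metric. *)
Definition star_inv (R : realType) n (G : 'M[R]_(n + n)) (b : covec R n) : covec R n :=
  xget 0 [set c | star G c = b].

(** * Calculus on open subsets of C^n *)

(** C^oo on the open set [U]: all the iterated directional derivatives are
    differentiable at every point of [U]. *)
Definition smooth_on (R : realType) m (U : set 'rV[R]_m) (f : 'rV[R]_m -> R) :=
  forall (s : seq 'rV[R]_m) (y : 'rV[R]_m), U y ->
    differentiable (foldr (fun v h => 'D_v h) f s) y.

Definition smooth_on_C (R : realType) m (U : set 'rV[R]_m) (f : 'rV[R]_m -> R[i]) :=
  smooth_on U (fun y => complex.Re (f y)) /\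
  smooth_on U (fun y => complex.Im (f y)).

(** Smooth with C-linear differential ([jacobian] acts on row vectors). *)
Definition holomorphic_on (R : realType) n (U : set 'rV[R]_(n + n))
    (f : 'rV[R]_(n + n) -> 'rV[R]_(n + n)) :=
  (forall k, smooth_on U (fun y => f y 0 k)) /\
  (forall y, U y -> Jmx R n *m jacobian f y = jacobian f y *m Jmx R n).

Definition derive_C (R : realType) m (k : 'I_m) (f : 'rV[R]_m -> R[i])
    (y : 'rV[R]_m) : R[i] :=
  'D_(basis_vec R k) (fun z => complex.Re (f z)) y
    +i* 'D_(basis_vec R k) (fun z => complex.Im (f z)) y.

(** Exterior derivative \sum_k dx_k /\ (d a / dx_k). *)
Definition ext_d (R : realType) n (a : 'rV[R]_(n + n) -> covec R n)
    (y : 'rV[R]_(n + n)) : covec R n :=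
  \sum_(k < n + n)
    wedge (dx R k) [ffun A : {set 'I_(n + n)} => derive_C k (fun z => a z A) y].

(** * Complex manifolds *)

(** [mparam i] is the inverse of the chart [mchart i : mdom i -> C^n]; the values
    of [mchart i] and [mparam i] outside [mdom i] and its image are irrelevant. *)
Record complex_manifold (R : realType) (n : nat) := ComplexManifold {
  mspace :> topologicalType;
  mindex : Type;
  mdom : mindex -> set mspace;
  mchart : mindex -> mspace -> 'rV[R]_(n + n);
  mparam : mindex -> 'rV[R]_(n + n) -> mspace;
  mspace_hausdorff : hausdorff_space mspace;
  mspace_second_countable : @second_countable mspace;
  mdom_cover : forall x, exists i, mdom i x;
  mdom_open : forall i, open (mdom i);
  mimg_open : forall i, open (mchart i @` mdom i);
  mchartK : forall i x, mdom i x -> mparam i (mchart i x) = x;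
  mchart_continuous : forall i, {within mdom i, continuous (mchart i)};
  mparam_continuous :
    forall i, {within mchart i @` mdom i, continuous (mparam i)};
  mtransition_holomorphic : forall i j,
    holomorphic_on [set y | (mchart i @` mdom i) y /\ mdom j (mparam i y)]
                   (mchart j \o mparam i)
}.

Definition mimg (R : realType) n (X : complex_manifold R n) (i : mindex X) :
  set 'rV[R]_(n + n) := @mchart R n X i @` @mdom R n X i.

(** Domain of the change of charts from [i] to [j]. *)
Definition moverlap (R : realType) n (X : complex_manifold R n) (i j : mindex X) :
  set 'rV[R]_(n + n) := [set y | mimg i y /\ mdom j (mparam i y)].

Definition mtransition (R : realType) n (X : complex_manifold R n) (i j : mindex X) :
  'rV[R]_(n + n) -> 'rV[R]_(n + n) := mchart j \o mparam i.

(** ** Hermitian and Kaehler metrics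

Tensors are given by their expressions in all the charts, which are only
meaningful on the images of the charts and have to agree on overlaps. *)

Definition metric_field (R : realType) n (X : complex_manifold R n) :=
  mindex X -> 'rV[R]_(n + n) -> 'M[R]_(n + n).

Definition riemannian_metric (R : realType) n (X : complex_manifold R n)
    (g : metric_field X) :=
  [/\ forall i a b, smooth_on (mimg i) (fun y => g i y a b),
      forall i y, mimg i y -> forall u v, gprod (g i y) u v = gprod (g i y) v u,
      forall i y, mimg i y -> forall u, u != 0 -> 0 < gprod (g i y) u u &
      forall i j y, moverlap i j y -> forall u v,
        gprod (g i y) u v =
        gprod (g j (mtransition i j y)) (u *m jacobian (mtransition i j) y)
                                        (v *m jacobian (mtransition i j) y)].

Definition hermitian_metric (R : realType) n (X : complex_manifold R n)
    (g : metric_field X) :=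
  riemannian_metric g /\
  forall i y, mimg i y -> forall u v,
    gprod (g i y) (u *m Jmx R n) (v *m Jmx R n) = gprod (g i y) u v.

(** ** Differential forms *)

Definition form (R : realType) n (X : complex_manifold R n) :=
  mindex X -> 'rV[R]_(n + n) -> covec R n.

Definition smooth_form (R : realType) n (X : complex_manifold R n) (a : form X) :=
  (forall i A, smooth_on_C (mimg i) (fun y => a i y A)) /\
  (forall i j y, moverlap i j y ->
     a i y = pullback (map_mx (real_complex R) (jacobian (mtransition i j) y))
                      (a j (mtransition i j y))).

Definition form_support (R : realType) n (X : complex_manifold R n) (a : form X) :
    set X :=
  closure [set x | exists i, mdom i x /\ a i (mchart i x) != 0].

Definition test_form (R : realType) n (X : complex_manifold R n) (a : form X) :=
  smooth_form a /\ compact (form_support a).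

(** ** Operators on forms *)

Definition form_op (R : realType) n (X : complex_manifold R n) := form X -> form X.

(** Equality of operators on smooth forms with compact support. *)
Definition op_eq (R : realType) n (X : complex_manifold R n) (S T : form_op X) :=
  forall a : form X, test_form a ->
  forall i y, mimg i y -> S a i y = T a i y.

Definition zero_op (R : realType) n (X : complex_manifold R n) : form_op X :=
  fun a i y => 0.

Definition scale_op (R : realType) n (X : complex_manifold R n) (c : R[i])
    (S : form_op X) : form_op X :=
  fun a i y => scalecv c (S a i y).

Definition commutator (R : realType) n (X : complex_manifold R n)
    (S T : form_op X) : form_op X :=
  fun a i y => S (T a) i y - T (S a) i y.

Definition d_op (R : realType) n (X : complex_manifold R n) : form_op X :=
  fun a i => ext_d (a i).

Definition type_op (R : realType) n (X : complex_manifold R n) (p q : nat) :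
    form_op X :=
  fun a i y => type_proj p q (a i y).

(** On forms of type (p, q), [del] is d followed by the projection to type
    (p + 1, q), and [delbar] is d followed by the projection to type
    (p, q + 1). *)
Definition del (R : realType) n (X : complex_manifold R n) : form_op X :=
  fun a i y => \sum_(p < n.+1) \sum_(q < n.+1)
    type_op p.+1 q (d_op (type_op p q a)) i y.

Definition delbar (R : realType) n (X : complex_manifold R n) : form_op X :=
  fun a i y => \sum_(p < n.+1) \sum_(q < n.+1)
    type_op p q.+1 (d_op (type_op p q a)) i y.

Definition kahler_form (R : realType) n (X : complex_manifold R n)
    (g : metric_field X) : form X :=
  fun i y => fundamental_form (g i y).

Definition kahler_metric (R : realType) n (X : complex_manifold R n)
    (g : metric_field X) :=
  hermitian_metric g /\
  forall i y, mimg i y -> d_op (kahler_form g) i y = 0.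

Definition Lefschetz (R : realType) n (X : complex_manifold R n)
    (g : metric_field X) : form_op X :=
  fun a i y => wedge (kahler_form g i y) (a i y).

Definition hodge (R : realType) n (X : complex_manifold R n)
    (g : metric_field X) : form_op X :=
  fun a i y => star (g i y) (a i y).

Definition hodge_inv (R : realType) n (X : complex_manifold R n)
    (g : metric_field X) : form_op X :=
  fun a i y => star_inv (g i y) (a i y).

Definition Lambda (R : realType) n (X : complex_manifold R n)
    (g : metric_field X) : form_op X :=
  hodge_inv g \o Lefschetz g \o hodge g.

Definition del_adj (R : realType) n (X : complex_manifold R n)
    (g : metric_field X) : form_op X :=
  scale_op (-1) (hodge g \o delbar (X := X) \o hodge g).

Definition delbar_adj (R : realType) n (X : complex_manifold R n)
    (g : metric_field X) : form_op X :=
  scale_op (-1) (hodge g \o del (X := X) \o hodge g).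

(* Main.v *)
From HB Require Import structures.
Require Import Defs.
From mathcomp Require Import all_boot all_order all_algebra ring.
From mathcomp Require Import complex reals.

(** The identities are local, and each of them involves first derivatives only, so
    they can be checked at a point y of a chart.  Write nabla_k for the covariant
    derivative of the Levi-Civita connection at y: it is the partial derivative
    minus the derivation of the exterior algebra induced by a matrix Gamma_k.  The
    connection preserves the metric, hence the Hodge star; the closedness of omega
    makes Gamma_k commute with J, so that nabla_k preserves omega and the types; and
    torsion-freeness gives d = \sum_k dx_k /\ nabla_k.  Hence del, delbar and their
    adjoints become \sum_k T_k nabla_k where the T_k are exterior multiplications by
    the (1,0) or (0,1) parts of the dx_k, possibly conjugated by the Hodge star, and
    everything follows from the pointwise identity
    [Lambda, x /\ _] = - * (Jx /\ _) *
    together with Jx = i x for x of type (1,0) and Jx = - i x for x of type (0,1).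
    Since * (x /\ _) * is the contraction with the dual of x, this identity is a
    consequence of the anticommutation relations between exterior multiplications
    and contractions. *)

Set Implicit Arguments.
Unset Strict Implicit.
Unset Printing Implicit Defensive.

Import Order.TTheory GRing.Theory Num.Theory.

Local Open Scope ring_scope.

(** * Creation and annihilation operators *)

(** No chart in which the metric osculates a flat one is constructed: the connection is computed in
    the given chart. The definitions speak of minors and shuffle signs. Signs are confronted for
    basis covectors only, through [crea] and [anni]; most identities between operators then follow
    by [ext_ind] from their values at 1 and their commutation with exterior multiplications. The
    metric star is a flat star followed by a pull-back, so that its derivative involves derivations
    and traces only. The sign of the orientation is left unspecified: the star enters each identity
    an even number of times. Since [delbar_adj] contains [del], the two share the holomorphic
    projector and the eigenvalue i, which is why the commutator of Lambda with [del] yields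
    [delbar_adj]. *)

Lemma scale_regE (K : comNzRingType) (c : K) (x : K^o) : c *: x = (c : K^o) * x.
Proof. by []. Qed.

Section ExteriorAlgebra.
Variables (K : fieldType) (m : nat).
Implicit Types (A B : {set 'I_m}) (i j k l : 'I_m) (P Q M N : 'M[K]_m).

(* The same encoding as [covec], over any field: [a] is \sum_A a A * dx_A. *)
Definition ext := {ffun {set 'I_m} -> K^o}.
Implicit Types a b : ext.

Lemma sign_ltC j k : j != k -> (-1) ^+ (k < j)%N = - (-1) ^+ (j < k)%N :> K.
Proof. by case: ltngtP => // [_|/val_inj->]; rewrite ?opprK ?eqxx. Qed.

(* dx_k /\ dx_A = sgn k A * dx_(k |: A) when k is not in A. *)
Definition sgn k A : K := (-1) ^+ #|[set l in A | (l < k)%N]|.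

Lemma sgn_sqr k A : sgn k A * sgn k A = 1.
Proof. by rewrite -expr2 sqrr_sign. Qed.

Lemma sgnD1 k l A : l \in A -> sgn k A = (-1) ^+ (l < k)%N * sgn k (A :\ l).
Proof.
move=> lA; rewrite /sgn (cardsD1 l) exprD inE lA /=; congr (_ * (-1) ^+ #|pred_of_set _|).
by apply/setP => x; rewrite !inE andbA.
Qed.

Lemma sgnU1 k l A : l \notin A -> sgn k (l |: A) = (-1) ^+ (l < k)%N * sgn k A.
Proof. by move=> lA; rewrite (@sgnD1 k l) ?setU11 // setU1K. Qed.

Definition extb A : ext := [ffun B : {set 'I_m} => (B == A)%:R].
Local Notation extone := (extb set0).

(** [crea k] is dx_k /\ _ and [anni k] is the contraction with e_k; [parity] is the sign (-1)^degree
    that appears when a covector is moved across a whole form. *)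
Definition crea k a : ext :=
  [ffun A : {set 'I_m} => if k \in A then sgn k A * a (A :\ k) else 0].
Definition anni k a : ext :=
  [ffun A : {set 'I_m} => if k \in A then 0 else sgn k A * a (k |: A)].
Definition parity a : ext := [ffun A : {set 'I_m} => (-1) ^+ #|A| * a A].

Fact crea_linear k : linear (crea k).
Proof.
move=> c a b; apply/ffunP => A; rewrite !ffunE.
case: ifP => _; last by rewrite scaler0 addr0.
by rewrite mulrDr !scale_regE mulrCA.
Qed.
HB.instance Definition _ k :=
  GRing.isLinear.Build K ext ext *:%R (crea k) (crea_linear k).

Fact anni_linear k : linear (anni k).
Proof.
move=> c a b; apply/ffunP => A; rewrite !ffunE.
case: ifP => _; first by rewrite scaler0 addr0.
by rewrite mulrDr !scale_regE mulrCA.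
Qed.
HB.instance Definition _ k :=
  GRing.isLinear.Build K ext ext *:%R (anni k) (anni_linear k).

Fact parity_linear : linear parity.
Proof.
move=> c a b; apply/ffunP => A; rewrite !ffunE.
by rewrite mulrDr !scale_regE mulrCA.
Qed.
HB.instance Definition _ :=
  GRing.isLinear.Build K ext ext *:%R parity parity_linear.

Lemma parityK a : parity (parity a) = a.
Proof. by apply/ffunP => A; rewrite !ffunE mulrA -expr2 sqrr_sign mul1r. Qed.

Lemma parity_crea k a : parity (crea k a) = - crea k (parity a).
Proof.
apply/ffunP => A; rewrite !ffunE; case: ifP => kA; last by rewrite mulr0 oppr0.
by rewrite (cardsD1 k A) kA exprS mulN1r mulrCA mulNr mulrN.
Qed.

Lemma parity_anni k a : parity (anni k a) = - anni k (parity a).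
Proof.
apply/ffunP => A; rewrite !ffunE; case: ifPn => kA; first by rewrite mulr0 oppr0.
by rewrite cardsU1 kA exprS mulN1r mulNr mulrN opprK mulrCA.
Qed.

Lemma parity_extone : parity extone = extone.
Proof.
apply/ffunP => A; rewrite !ffunE; case: eqVneq => [->|_]; last by rewrite mulr0.
by rewrite cards0 mul1r.
Qed.

Lemma crea_anti j k a : crea j (crea k a) = - crea k (crea j a).
Proof.
apply/ffunP => A; rewrite !ffunE !inE.
have [->|jk] := eqVneq j k; first by case: ifP; rewrite !(mulr0, oppr0).
rewrite /=.
case: ifPn => jA; case: ifPn => kA; rewrite ?(mulr0, oppr0) //.
rewrite (@sgnD1 j k A kA) (@sgnD1 k j A jA) setDDl setUC -setDDl !mulrA.
rewrite (sign_ltC jk).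
by rewrite !mulNr; congr (- (_ * _)); rewrite -!mulrA; congr (_ * _); rewrite mulrC.
Qed.

(** In characteristic 2 this does not follow from [crea_anti]. *)
Lemma crea_sqr k a : crea k (crea k a) = 0.
Proof. by apply/ffunP => A; rewrite !ffunE !inE eqxx; case: ifP; rewrite ?mulr0. Qed.

Lemma anni_crea j k a : anni j (crea k a) = (j == k)%:R *: a - crea k (anni j a).
Proof.
apply/ffunP => A; rewrite !ffunE !inE scale_regE.
have [<-|jk] := eqVneq j k; rewrite /= ?(mul1r, mul0r, add0r).
  case: ifPn => jA; last by rewrite subr0 mulrA sgnU1 // ltnn mul1r sgn_sqr mul1r setU1K.
  by rewrite /= setD1K // mulrA (@sgnD1 j j A) // ltnn mul1r sgn_sqr mul1r subrr.
rewrite /=.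
case: ifPn => jA; case: ifPn => kA; rewrite ?(mulr0, oppr0) //.
have -> : (j |: A) :\ k = j |: (A :\ k).
  by apply/setP => x; rewrite !inE; case: eqVneq => // ->;
  case: eqVneq => // /eqP; rewrite eq_sym (negPf jk).
rewrite sgnU1 // (@sgnD1 j k A kA) (sign_ltC jk) !mulrA !mulNr; congr (- (_ * _)).
by rewrite -mulrA mulrACA -expr2 sqrr_sign mul1r mulrC.
Qed.

Lemma anni_extone k : anni k extone = 0.
Proof.
apply/ffunP => A; rewrite !ffunE; case: ifP => // _.
by rewrite -subset0 subUset sub1set inE mulr0.
Qed.

Lemma crea_extb k A :
  crea k (extb A) = (if k \in A then 0 else sgn k A) *: extb (k |: A).
Proof.
apply/ffunP => B; rewrite !ffunE scale_regE.
have [kB|kB] := ifPn; last first.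
  rewrite (_ : B == _ = false) ?mulr0 //.
  by apply: contraNF kB => /eqP->; rewrite setU11.
have [->|BkA] := eqVneq B (k |: A).
  have [kA|kA] := ifPn; last by rewrite setU1K // eqxx sgnU1 // ltnn mul1r.
  rewrite mul0r (_ : _ == A = false) ?mulr0 //.
  by apply: contraTF kA => /eqP <-; rewrite setD11.
rewrite mulr0 (_ : _ == A = false) ?mulr0 //.
by apply: contra_neqF BkA => /eqP <-; rewrite setD1K.
Qed.

Lemma extE a : a = \sum_A a A *: extb A.
Proof.
apply/ffunP => B; rewrite sum_ffunE (bigD1 B) //= big1 ?addr0 => [|A AB].
  by rewrite !ffunE eqxx scale_regE mulr1.
by rewrite !ffunE eq_sym (negPf AB) scale_regE mulr0.
Qed.

Definition creav (x : 'cV[K]_m) a : ext := \sum_j x j 0 *: crea j a.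
Definition anniv (x : 'cV[K]_m) a : ext := \sum_j x j 0 *: anni j a.

Fact creav_linear x : linear (creav x).
Proof.
move=> c a b; rewrite /creav scaler_sumr -big_split; apply: eq_bigr => j _ /=.
by rewrite linearP scalerDr !scalerA mulrC.
Qed.
HB.instance Definition _ x :=
  GRing.isLinear.Build K ext ext *:%R (creav x) (creav_linear x).

Fact anniv_linear x : linear (anniv x).
Proof.
move=> c a b; rewrite /anniv scaler_sumr -big_split; apply: eq_bigr => j _ /=.
by rewrite linearP scalerDr !scalerA mulrC.
Qed.
HB.instance Definition _ x :=
  GRing.isLinear.Build K ext ext *:%R (anniv x) (anniv_linear x).

Lemma creavDl x y a : creav (x + y) a = creav x a + creav y a.
Proof. by rewrite -big_split; apply: eq_bigr => j _; rewrite mxE scalerDl. Qed.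

Lemma creavZl c x a : creav (c *: x) a = c *: creav x a.
Proof. by rewrite scaler_sumr; apply: eq_bigr => j _; rewrite mxE scalerA. Qed.

Lemma creav0l a : creav 0 a = 0.
Proof. by rewrite -(scale0r 0) creavZl scale0r. Qed.

Lemma creav_suml (I : Type) (r : seq I) (F : I -> 'cV[K]_m) a :
  creav (\sum_(i <- r) F i) a = \sum_(i <- r) creav (F i) a.
Proof. by apply: (big_morph (creav^~ a)) => [x y|]; rewrite ?creavDl ?creav0l. Qed.

Lemma creav_delta k a : creav (delta_mx k 0) a = crea k a.
Proof.
rewrite /creav (bigD1 k) //= big1 ?addr0 ?mxE ?eqxx ?scale1r // => j jk.
by rewrite mxE (negPf jk) scale0r.
Qed.

Lemma anniv_delta k a : anniv (delta_mx k 0) a = anni k a.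
Proof.
rewrite /anniv (bigD1 k) //= big1 ?addr0 ?mxE ?eqxx ?scale1r // => j jk.
by rewrite mxE (negPf jk) scale0r.
Qed.

Lemma creav_anti x y a : creav x (creav y a) = - creav y (creav x a).
Proof.
rewrite {1 3}/creav -sumrN.
under eq_bigr do rewrite linear_sum scaler_sumr.
rewrite exchange_big; apply: eq_bigr => k _ /=.
rewrite linear_sum scaler_sumr -sumrN; apply: eq_bigr => j _.
by rewrite !linearZ /= !scalerA crea_anti scalerN mulrC.
Qed.

(** The terms (j, k) and (k, j) cancel and the diagonal ones vanish, which avoids a division by
    2. *)
Lemma creav_sqr x a : creav x (creav x a) = 0.
Proof.
rewrite {1}/creav; under eq_bigr do rewrite linear_sum scaler_sumr.
rewrite pair_bigA /= (bigID (fun p : 'I_m * 'I_m => (p.1 < p.2)%N)) /=.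
rewrite [X in _ + X](bigID (fun p : 'I_m * 'I_m => (p.1 == p.2)%N)) /=.
rewrite [X in _ + (X + _)]big1 ?add0r; last first.
  by move=> [j k] /= /andP[_ /eqP<-]; rewrite linearZ /= crea_sqr !scaler0.
rewrite [X in _ + X](reindex_inj (h := fun p : 'I_m * 'I_m => (p.2, p.1))) /=; last first.
  by move=> [? ?] [? ?] [-> ->].
rewrite [X in _ + X](eq_bigl (fun p : 'I_m * 'I_m => (p.1 < p.2)%N)); last first.
  by move=> [j k] /=; rewrite -leqNgt ltn_neqAle andbC eq_sym.
rewrite -big_split big1 // => -[j k] _ /=.
by rewrite !linearZ /= !scalerA [x k 0 * _]mulrC crea_anti scalerN addNr.
Qed.

Lemma anniv_creav x y a :
  anniv x (creav y a) = (x^T *m y) 0 0 *: a - creav y (anniv x a).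
Proof.
transitivity (\sum_j \sum_k
    (x j 0 * y k 0) *: ((j == k)%:R *: a - crea k (anni j a))).
  apply: eq_bigr => j _; rewrite linear_sum scaler_sumr; apply: eq_bigr => k _.
  by rewrite linearZ /= anni_crea scalerA.
under eq_bigr do under eq_bigr do rewrite scalerBr.
under eq_bigr do rewrite sumrB.
rewrite sumrB; congr (_ - _).
  rewrite mxE scaler_suml; apply: eq_bigr => j _; rewrite (bigD1 j) //= big1.
    by rewrite eqxx scale1r addr0 mxE.
  by move=> k kj; rewrite eq_sym (negPf kj) scale0r scaler0.
rewrite exchange_big; apply: eq_bigr => k _ /=.
rewrite linear_sum scaler_sumr; apply: eq_bigr => j _.
by rewrite linearZ /= scalerA mulrC.
Qed.

Lemma parity_creav x a : parity (creav x a) = - creav x (parity a).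
Proof.
rewrite linear_sum -sumrN; apply: eq_bigr => j _.
by rewrite linearZ /= parity_crea scalerN.
Qed.

Lemma parity_anniv x a : parity (anniv x a) = - anniv x (parity a).
Proof.
rewrite linear_sum -sumrN; apply: eq_bigr => j _.
by rewrite linearZ /= parity_anni scalerN.
Qed.

Lemma anniv_extone x : anniv x extone = 0.
Proof. by rewrite /anniv big1 // => j _; rewrite anni_extone scaler0. Qed.

(** The algebra is generated from 1 by exterior multiplications. Hence two linear operators agree as
    soon as they agree at 1 and obey the same commutation rule with every [creav x]. *)
Lemma ext_ind (Q : ext -> Prop) :
  Q extone -> (forall c a b, Q a -> Q b -> Q (c *: a + b)) ->
  (forall x a, Q a -> Q (creav x a)) -> forall a, Q a.
Proof.
move=> Q1 QD Qc.
have Q0 : Q 0 by rewrite -(addNr extone) -scaleN1r; exact: QD.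
have Qb A : Q (extb A).
  have [p] := ubnP #|A|; elim: p A => // p IH A /ltnSE leA.
  have [->|/set0Pn[k kA]] := eqVneq A set0; first exact: Q1.
  have -> : extb A = sgn k A *: creav (delta_mx k 0) (extb (A :\ k)) + 0.
    rewrite addr0 creav_delta crea_extb setD11 setD1K // scalerA.
    by rewrite (@sgnD1 k k A) // ltnn mul1r sgn_sqr scale1r.
  apply: QD => //; apply/Qc/IH/leq_trans/leA.
  by rewrite [leqRHS](cardsD1 k) kA.
move=> a; rewrite (extE a).
by apply: big_ind => // [b c|A _]; [rewrite -{2}[b]scale1r | rewrite -[_ *: _]addr0]; auto.
Qed.

End ExteriorAlgebra.

(** * Pull-backs and derivations *)

Lemma eq_det (K : comNzRingType) p q (M : 'M[K]_p) (N : 'M[K]_q) :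
  p = q ->
  (forall (i j : 'I_p) (i' j' : 'I_q), i = i' :> nat -> j = j' :> nat ->
     M i j = N i' j') ->
  \det M = \det N.
Proof. by move=> ?; subst q => MN; congr (\det _); apply/matrixP => i j; exact: MN. Qed.

(** Needed to match the row deleted by a cofactor with the enumeration of [B :\ b]. Two strictly
    increasing lists with the same elements are equal. *)
Lemma enum_set_split m (B : {set 'I_m}) (b : 'I_m) (L := [set l in B | (l < b)%N])
    (U := [set l in B | (b < l)%N]) : b \in B ->
  enum B = enum L ++ b :: enum U /\ enum (B :\ b) = enum L ++ enum U.
Proof.
move=> bB; pose r := [rel x y : 'I_m | (x < y)%N].
have rtr : transitive r by move=> ? ? ?; exact: ltn_trans.
have rir : irreflexive r by move=> ?; exact: ltnn.
have srt (A : {set 'I_m}) : sorted r (enum A).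
  have : sorted r (enum 'I_m).
    by rewrite -(@sorted_map _ _ val ltn) val_enum_ord iota_ltn_sorted.
  by rewrite enumT; exact: sorted_filter.
have pw := sorted_pairwise rtr.
have LU : allrel r (enum L) (enum U).
  apply/allrelP => x y; rewrite !mem_enum !inE => /andP[_ xb] /andP[_].
  exact: ltn_trans.
split; apply: (irr_sorted_eq rtr rir) => //; rewrite ?pw ?pairwise_cat.
- rewrite /= -!pw !srt /= andbT.
  apply/andP; split; last by apply/allP => x; rewrite mem_enum inE => /andP[].
  apply/allrelP => x y; rewrite inE => xL /predU1P[->|yU]; last exact: (allrelP LU).
  by move: xL; rewrite mem_enum inE => /andP[].
- move=> x; rewrite mem_cat inE !mem_enum !inE.
  rewrite -val_eqE /=.
  by case: (ltngtP (val x) b) => [||/val_inj->]; rewrite ?bB ?orbT ?andbT ?andbF //= ?orbF.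
- by rewrite -!pw !srt LU.
- move=> x; rewrite mem_cat !mem_enum !inE neq_ltn.
  by case: (x \in B); rewrite ?andbF ?andbT.
Qed.

Section Pullback.
Variables (K : fieldType) (m : nat).
Implicit Types (A B : {set 'I_m}) (i j k l : 'I_m) (P Q M N : 'M[K]_m).
Implicit Types a b : ext K m.

(** Laplace expansion: the least element k of A is column 0, so the cofactor sign only counts the
    elements of B before b, which is [sgn K b B]. *)
Lemma minor_expand P A B k : k \in A -> (forall l, l \in A -> (k <= l)%N) ->
  minor P B A = \sum_(b in B) sgn K b B * P b k * minor P (B :\ b) (A :\ k).
Proof.
move=> kA kmin; rewrite /minor.
have [eqBA|neBA] := eqVneq; last first.
  apply/esym/big1 => b bB; rewrite ifN ?mulr0 //; apply: contra_neq neBA.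
  by rewrite (cardsD1 b B) (cardsD1 k A) bB kA => ->.
have cA : (0 < #|B|)%N by rewrite eqBA (cardsD1 k A) kA.
rewrite (expand_det_col _ (Ordinal cA)) [RHS]big_enum_val; apply: eq_bigr => i _.
have [eA eAk] := enum_set_split kA.
have [eB eBb] := enum_set_split (enum_valP i).
have L0 : [set l in A | (l < k)%N] = set0.
  by apply/setP => l; rewrite !inE; apply/negP => /andP[/kmin]; rewrite leqNgt => /negP.
rewrite L0 enum_set0 /= in eA eAk.
have bB := enum_valP i; set b := enum_val i in eB eBb bB *.
set U := [set l in A | _] in eA eAk; set Lb := [set l in B | _] in eB eBb.
set Ub := [set l in B | (b < l)%N] in eB eBb.
have iE : i = #|Lb| :> nat.
  have iB : (i < size (enum B))%N by rewrite -cardE.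
  rewrite -(index_uniq b iB (enum_uniq _)) -enum_val_nth -/b eB index_cat mem_enum inE ltnn andbF.
  by rewrite /= eqxx addn0 cardE.
rewrite mxE eA /= [sgn _ _ _ * _]mulrC -mulrA -/b; congr (_ * _).
rewrite /cofactor addn0 /sgn iE; congr (_ * _).
have cBA : #|B :\ b| = #|A :\ k|.
  by move: eqBA; rewrite (cardsD1 b B) (cardsD1 k A) bB kA => /addnI.
rewrite ifT ?cBA //; apply: eq_det => [|i1 j1 i2 j2 i12 j12].
  by rewrite (cardsD1 b B) bB.
rewrite !mxE (enum_val_nth b) [enum_val i2](enum_val_nth b) eAk eB eBb /=.
rewrite add0n j12 -i12.
congr (P _ _); last first.
  by apply: set_nth_default; rewrite -eAk -cardE -cBA; move: (ltn_ord j2).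
(* [bump] jumps over the row of b, just as positions in [enum (B :\ b)] are shifted when b is put
   back. *)
rewrite /bump iE !nth_cat -cardE; case: (leqP #|Lb| i1) => h.
  by rewrite add1n ltnNge leqW //= subSn.
by rewrite add0n h.
Qed.

(* [pullback] over any field. *)
Definition pb P a : ext K m :=
  [ffun B : {set 'I_m} => \sum_(A : {set 'I_m}) a A * minor P B A].

Fact pb_linear P : linear (pb P).
Proof.
move=> c a b; apply/ffunP => B; rewrite !ffunE scale_regE mulr_sumr -big_split.
by apply: eq_bigr => A _; rewrite !ffunE scale_regE mulrDl mulrA.
Qed.
HB.instance Definition _ P :=
  GRing.isLinear.Build K (ext K m) (ext K m) *:%R (pb P) (pb_linear P).

Lemma pb_extb P A : pb P (extb K A) = [ffun B : {set 'I_m} => minor P B A].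
Proof.
apply/ffunP => B; rewrite !ffunE (bigD1 A) //= ffunE eqxx mul1r big1 ?addr0 //.
by move=> C /negPf CA; rewrite ffunE CA mul0r.
Qed.

Lemma pb_extone P : pb P (extb K set0) = extb K set0.
Proof.
rewrite pb_extb; apply/ffunP => B; rewrite !ffunE /minor cards0 cards_eq0.
case: eqP => // ->.
by move: (matrix_of_fun _ _) => /=; rewrite cards0 => N; rewrite det_mx00.
Qed.

(** For k below all of A this is [minor_expand]. Otherwise the least element l of A is brought to
    the front, k and l are exchanged by anticommutation on both sides, and induction on the size of
    A applies. *)
Lemma pb_crea P k a : pb P (crea k a) = creav (col k P) (pb P a).
Proof.
have step A l : (forall i, i \in A -> (l < i)%N) ->
    pb P (extb K (l |: A)) = creav (col l P) (pb P (extb K A)).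
  move=> lA; rewrite !pb_extb; apply/ffunP => B; rewrite sum_ffunE ffunE.
  have lNA : l \notin A by apply/negP => /lA; rewrite ltnn.
  rewrite (@minor_expand _ _ _ l) ?setU11 //; last first.
    by move=> i /setU1P[->|/lA/ltnW].
  rewrite setU1K // big_mkcond; apply: eq_bigr => j _.
  by rewrite !ffunE scale_regE mxE; case: ifP => _; rewrite ?mulr0 // mulrCA mulrA.
have creaS A l : (forall i, i \in A -> (l < i)%N) ->
    crea l (extb K A) = extb K (l |: A).
  move=> lA; rewrite crea_extb ifN; last by apply/negP => /lA; rewrite ltnn.
  rewrite /sgn (_ : [set _ in _ | _] = set0) ?cards0 ?scale1r //.
  by apply/setP => i; rewrite !inE; apply/negP => /andP[/lA]; case: ltngtP.
suff base A : pb P (crea k (extb K A)) = creav (col k P) (pb P (extb K A)).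
  rewrite (extE a) !linear_sum; apply: eq_bigr => A _ /=.
  by rewrite !linearZ /= base.
have [p] := ubnP #|A|; elim: p A k => // p IH A k /ltnSE leA.
have [kA|] := boolP [forall i in A, (k < i)%N].
  by rewrite creaS ?step //; exact/forall_inP.
rewrite negb_forall_in => /exists_inP[i0 i0A]; rewrite -leqNgt => i0k.
case: (arg_minnP val i0A) => l lA0 lmin; have lA : l \in A := lA0.
have lk : (l <= k)%N := leq_trans (lmin _ i0A) i0k.
have lA' i : i \in A :\ l -> (l < i)%N.
  by rewrite !inE => /andP[il /lmin]; rewrite leq_eqVlt val_eqE eq_sym (negPf il).
have leA' : (#|A :\ l| < p)%N by apply: leq_trans leA; rewrite [leqRHS](cardsD1 l) lA.
rewrite -(setD1K lA) step // -creaS //.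
have [->|kl] := eqVneq k l; first by rewrite creav_sqr crea_sqr linear0.
have llk : (l < k)%N by rewrite ltn_neqAle lk eq_sym andbT.
rewrite crea_anti creav_anti -IH // linearN /= crea_extb !linearZ /=.
have lkA i : i \in k |: A :\ l -> (l < i)%N by move=> /setU1P[->|/lA'].
by rewrite creaS // step.
Qed.

Lemma pb_creav P (x : 'cV[K]_m) a : pb P (creav x a) = creav (P *m x) (pb P a).
Proof.
rewrite {1}/creav linear_sum; under eq_bigr do rewrite linearZ /= pb_crea.
rewrite /creav; under eq_bigr do rewrite scaler_sumr.
rewrite exchange_big; apply: eq_bigr => j _; rewrite mxE scaler_suml.
by apply: eq_bigr => k _; rewrite scalerA mxE mulrC.
Qed.

(** On coefficients this is the Cauchy-Binet formula; [ext_ind] reduces it to the associativity of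
    the matrix product. *)
Lemma pb_mul P Q a : pb P (pb Q a) = pb (P *m Q) a.
Proof.
elim/ext_ind: a => [|c a b IHa IHb|x a IH]; first by rewrite !pb_extone.
- by rewrite !linearP /= IHa IHb.
- by rewrite !pb_creav IH mulmxA.
Qed.

Lemma pb1 a : pb 1%:M a = a.
Proof.
elim/ext_ind: a => [|c a b IHa IHb|x a IH]; first by rewrite pb_extone.
- by rewrite linearP /= IHa IHb.
- by rewrite pb_creav IH mul1mx.
Qed.

Lemma anniv_pb P y a : anniv y (pb P a) = pb P (anniv (P^T *m y) a).
Proof.
elim/ext_ind: a => [|c a b IHa IHb|x a IH].
- by rewrite pb_extone !anniv_extone linear0.
- by rewrite !linearP /= IHa IHb.
- rewrite pb_creav !anniv_creav linearB linearZ /= pb_creav IH.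
  by rewrite trmx_mul trmxK mulmxA.
Qed.

Lemma parity_pb P a : parity (pb P a) = pb P (parity a).
Proof.
elim/ext_ind: a => [|c a b IHa IHb|x a IH].
- by rewrite pb_extone !parity_extone pb_extone.
- by rewrite !linearP /= IHa IHb.
- by rewrite pb_creav !parity_creav linearN /= pb_creav IH.
Qed.

Lemma pb_exttop P : pb P (extb K setT) = \det P *: extb K setT.
Proof.
rewrite pb_extb; apply/ffunP => B; rewrite !ffunE scale_regE /minor.
have [->|BT] := eqVneq B setT; last first.
  rewrite mulr0 ifN //; apply: contraNneq BT => cB.
  by rewrite eqEcard subsetT cB leqnn.
rewrite eqxx mulr1; apply: eq_det => [|i j i' j' ii' jj'].
  by rewrite cardsT card_ord.
have eT : enum [set: 'I_m] = enum 'I_m by apply: eq_enum => x; rewrite !inE.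
rewrite mxE (enum_val_nth i') eT.
by congr (P _ _); apply/val_inj; rewrite /= nth_enum_ord ?ii' ?jj'.
Qed.

(* The derivation of the exterior algebra mapping dx_k to the k-th column of M. *)
Definition rho M a : ext K m := \sum_k creav (col k M) (anni k a).

Fact rho_linear M : linear (rho M).
Proof.
move=> c a b; rewrite /rho scaler_sumr -big_split; apply: eq_bigr => j _ /=.
by rewrite !linearP.
Qed.
HB.instance Definition _ M :=
  GRing.isLinear.Build K (ext K m) (ext K m) *:%R (rho M) (rho_linear M).

Lemma rhoDl M N a : rho (M + N) a = rho M a + rho N a.
Proof.
rewrite /rho -big_split; apply: eq_bigr => k _ /=.
by rewrite linearD creavDl.
Qed.

Lemma rho_extone M : rho M (extb K set0) = 0.
Proof. by rewrite /rho big1 // => k _; rewrite anni_extone linear0. Qed.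

Lemma rho_creav M x a :
  rho M (creav x a) = creav (M *m x) a + creav x (rho M a).
Proof.
rewrite /rho [X in _ + X]linear_sum.
have -> : M *m x = \sum_k x k 0 *: col k M.
  by apply/matrixP => i j; rewrite mxE summxE; apply: eq_bigr => k _; rewrite !mxE ord1 mulrC.
rewrite creav_suml -big_split; apply: eq_bigr => k _ /=.
rewrite -!anniv_delta anniv_creav creavZl linearB linearZ /=.
by rewrite creav_anti opprK trmx_delta -rowE mxE.
Qed.

Lemma pb_rho P M N a : P *m M = N *m P -> pb P (rho M a) = rho N (pb P a).
Proof.
move=> PM; elim/ext_ind: a => [|c a b IHa IHb|x a IH].
- by rewrite pb_extone !rho_extone linear0.
- by rewrite !linearP /= IHa IHb.
- by rewrite pb_creav !rho_creav linearD /= !pb_creav IH !mulmxA PM.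
Qed.

Lemma parity_rho M a : parity (rho M a) = rho M (parity a).
Proof.
rewrite /rho linear_sum; apply: eq_bigr => k _ /=.
by rewrite parity_creav parity_anni linearN opprK.
Qed.

Lemma creav_exttop (x : 'cV[K]_m) : creav x (extb K setT) = 0.
Proof.
by rewrite /creav big1 // => k _; rewrite crea_extb inE scale0r scaler0.
Qed.

(** Exterior multiplications kill the top form, so the anticommutation relation leaves only the
    diagonal entries of M. *)
Lemma rho_exttop M : rho M (extb K setT) = \tr M *: extb K setT.
Proof.
rewrite scaler_suml; apply: eq_bigr => k _.
have := anniv_creav (delta_mx k 0) (col k M) (extb K setT).
rewrite creav_exttop linear0 => /esym/eqP; rewrite subr_eq0 anniv_delta => /eqP <-.
by rewrite trmx_delta -rowE !mxE.
Qed.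

End Pullback.

(** * The Euclidean Hodge star *)

Section FlatStar.
Variables (K : fieldType) (m : nat).
Implicit Types (A B : {set 'I_m}) (i j k l : 'I_m) (P Q M N G H : 'M[K]_m).
Implicit Types (a b : ext K m) (x y : 'cV[K]_m).
Local Notation extone := (extb K (@set0 'I_m)).
Local Notation exttop := (extb K [set: 'I_m]).

(* [shuffle_sign] over any field. *)
Definition shs A B : K :=
  (-1) ^+ #|[pred p : 'I_m * 'I_m | [&& p.1 \in A, p.2 \in B & (p.2 < p.1)%N]]|.

Lemma sgnE k A : sgn K k A = \prod_(l in A) (-1) ^+ (l < k)%N.
Proof.
rewrite prodrXr /sgn -sum1_card; congr (_ ^+ _).
rewrite big_mkcond [RHS]big_mkcond; apply: eq_bigr => l _.
by rewrite inE; case: (l \in A); case: ltngtP.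
Qed.

Lemma shsE A B : shs A B = \prod_(k in A) sgn K k B.
Proof.
under eq_bigr do rewrite sgnE.
rewrite pair_big_dep /= prodrXr /shs -sum1_card; congr (_ ^+ _).
rewrite big_mkcond [RHS]big_mkcond; apply: eq_bigr => -[k l] _.
by rewrite inE /=; case: (k \in A); case: (l \in B); case: ltngtP.
Qed.

Lemma shsU1l k A B : k \notin A -> shs (k |: A) B = sgn K k B * shs A B.
Proof. by move=> kA; rewrite !shsE big_setU1. Qed.

(** Each l in A lies below or above k: [sgn K k A] counts the former, the shuffle counts the latter,
    whence the correction (-1)^#|A|. *)
Lemma shsU1r k A B : k \notin A -> k \notin B ->
  shs A (k |: B) = (-1) ^+ #|A| * sgn K k A * shs A B.
Proof.
move=> kA kB; rewrite !shsE -sum1_card -prodrXr sgnE -!big_split /=.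
apply: eq_bigr => l lA; rewrite sgnU1 // expr1; congr (_ * _).
have lk : l != k by apply: contraNneq kA => <-.
by rewrite (sign_ltC K lk) mulN1r.
Qed.

(* The Hodge star of the Gram matrix 1 for the orientation dx_1 /\ ... /\ dx_m. *)
Definition fstar a : ext K m :=
  [ffun B : {set 'I_m} => shs (~: B) B * a (~: B)].

Fact fstar_linear : linear fstar.
Proof.
move=> c a b; apply/ffunP => A; rewrite !ffunE.
by rewrite mulrDr !scale_regE mulrCA.
Qed.
HB.instance Definition _ :=
  GRing.isLinear.Build K (ext K m) (ext K m) *:%R fstar fstar_linear.

(** The star takes complements, so inserting k becomes removing it; the parity accounts for the
    factor (-1)^#|A| of [shsU1r]. *)
Lemma fstar_crea k a : fstar (crea k a) = anni k (fstar (parity a)).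
Proof.
apply/ffunP => B; rewrite !ffunE inE; case: ifPn => [kB|]; last first.
  by rewrite negbK => ->; rewrite mulr0.
rewrite (negPf kB); set A := ~: B :\ k.
have eB : ~: (k |: B) = A by apply/setP => x; rewrite !inE negb_or.
have kA : k \notin A by rewrite !inE eqxx.
have eA : ~: B = k |: A by rewrite setD1K // inE.
rewrite eB eA shsU1l // shsU1r // sgnU1 // ltnn mul1r !mulrA; congr (_ * _).
rewrite -!mulrA; congr (_ * _).
have e2 : (-1) ^+ #|A| * (-1) ^+ #|A| = 1 :> K by rewrite -expr2 sqrr_sign.
by rewrite [RHS]mulrC -!mulrA e2 mulr1 mulrC.
Qed.

Lemma fstar_anni k a : fstar (anni k a) = - crea k (fstar (parity a)).
Proof.
apply/ffunP => B; rewrite !ffunE inE; case: ifPn => [|kB].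
  by move=> /negPf ->; rewrite mulr0 oppr0.
rewrite negbK in kB; rewrite kB; set A := ~: B; set C := B :\ k.
have eB : B = k |: C by rewrite setD1K.
have kA : k \notin A by rewrite inE kB.
have kC : k \notin C by rewrite !inE eqxx.
have eA : ~: C = k |: A by apply/setP => x; rewrite !inE negb_and negbK.
have sB : shs A B = (-1) ^+ #|A| * sgn K k A * shs A C by rewrite [in LHS]eB shsU1r.
have gB : sgn K k B = sgn K k C by rewrite [in LHS]eB sgnU1 // ltnn mul1r.
rewrite eA shsU1l // sB gB cardsU1 kA exprS mulN1r !mulrA mulrN mulNr opprK.
congr (_ * _); rewrite [LHS]mulrAC -[_ * _ * sgn K k A]mulrA !sgn_sqr mulr1 mul1r.
exact: mulrC.
Qed.

Lemma fstar_creav x a : fstar (creav x a) = anniv x (fstar (parity a)).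
Proof.
rewrite linear_sum; apply: eq_bigr => k _.
by rewrite linearZ /= fstar_crea.
Qed.

Lemma fstar_anniv x a : fstar (anniv x a) = - creav x (fstar (parity a)).
Proof.
rewrite linear_sum -sumrN; apply: eq_bigr => k _.
by rewrite linearZ /= fstar_anni scalerN.
Qed.

Lemma fstar_parity a : fstar (parity a) = (-1) ^+ m *: parity (fstar a).
Proof.
apply/ffunP => B; rewrite !ffunE scale_regE.
have -> : (-1) ^+ #|~: B| = (-1) ^+ m * (-1) ^+ #|B| :> K.
  have mE : m = (#|B| + #|~: B|)%N by rewrite cardsC card_ord.
  rewrite [X in _ = (-1) ^+ X * _]mE exprD mulrAC -expr2 sqrr_sign.
  by rewrite mul1r.
by rewrite mulrCA -mulrA.
Qed.

Lemma fstar_extone : fstar extone = exttop.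
Proof.
apply/ffunP => B; rewrite !ffunE.
have [->|BT] := eqVneq B setT; last first.
  by rewrite -(inj_eq (can_inj (@setCK _))) setCK setC0 (negPf BT) mulr0.
by rewrite setCT eqxx shsE big_set0 mul1r.
Qed.

Lemma fstar_exttop : fstar exttop = extone.
Proof.
apply/ffunP => B; rewrite !ffunE.
have [->|B0] := eqVneq B set0; last first.
  by rewrite -(inj_eq (can_inj (@setCK _))) setCK setCT (negPf B0) mulr0.
rewrite setC0 eqxx shsE mulr1 big1 // => k _.
by rewrite sgnE big_set0.
Qed.

(** Infinitesimal form of [fstar_pb] at P = 1: the determinant gives the trace, the inverse
    transpose gives - M^T. *)
Lemma fstar_rho M a : fstar (rho M a) = \tr M *: fstar a - rho M^T (fstar a).
Proof.
have S k : fstar (creav (col k M) (anni k a)) =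
    M k k *: fstar a - creav (delta_mx k 0) (anniv (col k M) (fstar a)).
  rewrite fstar_creav -anniv_delta parity_anniv linearN linearN /= fstar_anniv.
  rewrite parityK linearN opprK /= anniv_creav; congr (_ *: _ - _).
  by rewrite -colE !mxE.
rewrite {1}/rho linear_sum /=; under eq_bigr do rewrite S.
rewrite sumrB -scaler_suml; congr (_ - _).
rewrite /rho /creav [RHS]exchange_big; apply: eq_bigr => k _ /=.
rewrite -/(creav (delta_mx k 0) _) creav_delta /anniv linear_sum.
by apply: eq_bigr => j _; rewrite linearZ /= !mxE.
Qed.

(* Hodge duality between complementary minors *)
Lemma fstar_pb P Q a : P *m Q = 1%:M -> fstar (pb P a) = \det P *: pb Q^T (fstar a).
Proof.
move=> PQ; elim/ext_ind: a => [|c a b IHa IHb|x a IH].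
- rewrite pb_extone fstar_extone pb_exttop scalerA det_tr -det_mulmx PQ det1.
  by rewrite scale1r.
- by rewrite !linearP /= IHa IHb.
- have QP := mulmx1C PQ.
  rewrite pb_creav !fstar_creav !fstar_parity IH !linearZ /= parity_pb.
  by rewrite anniv_pb trmxK mulmxA QP mul1mx.
Qed.

End FlatStar.

(** * Lefschetz operators of an inner product *)

Section Lefschetz.
Variables (K : fieldType) (m : nat).
Implicit Types (M N G H W : 'M[K]_m) (a b : ext K m) (x y : 'cV[K]_m).

(* Exterior product with \sum_(i < j) W i j * dx_i /\ dx_j, for antisymmetric W;
   see [lef_ltE]. *)
Definition lef W a : ext K m :=
  2%:R^-1 *: \sum_k creav (col k W) (creav (delta_mx k 0) a).

Fact lef_linear W : linear (lef W).
Proof.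
move=> c a b; rewrite /lef scalerA mulrC -scalerA -scalerDr; congr (_ *: _).
rewrite scaler_sumr -big_split; apply: eq_bigr => j _ /=.
by rewrite !linearP.
Qed.
HB.instance Definition _ W :=
  GRing.isLinear.Build K (ext K m) (ext K m) *:%R (lef W) (lef_linear W).

Lemma lefDl W M a : lef (W + M) a = lef W a + lef M a.
Proof.
rewrite /lef -scalerDr -big_split; congr (_ *: _); apply: eq_bigr => k _ /=.
by rewrite linearD creavDl.
Qed.

Lemma lef_creav W x a : lef W (creav x a) = creav x (lef W a).
Proof.
rewrite /lef linearZ /=; congr (_ *: _); rewrite linear_sum; apply: eq_bigr => k _ /=.
by rewrite [creav (delta_mx _ _) _]creav_anti linearN /= creav_anti opprK.
Qed.

Lemma parity_lef W a : parity (lef W a) = lef W (parity a).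
Proof.
rewrite /lef linearZ /=; congr (_ *: _); rewrite linear_sum; apply: eq_bigr => k _ /=.
by rewrite !parity_creav linearN opprK.
Qed.

(** Leibniz rule on both factors of each term of the 2-form. For the connection matrix, M W + W M^T
    will be the partial derivative of W, which expresses that omega is parallel. *)
Lemma rho_lef M W a :
  rho M (lef W a) = lef (M *m W + W *m M^T) a + lef W (rho M a).
Proof.
rewrite lefDl /lef -!scalerDr linearZ /=; congr (_ *: _); rewrite linear_sum.
have -> : \sum_k creav (col k (W *m M^T)) (creav (delta_mx k 0) a) =
    \sum_k creav (col k W) (creav (M *m delta_mx k 0) a).
  transitivity (\sum_k \sum_j M k j *: creav (col j W) (creav (delta_mx k 0) a)).
    apply: eq_bigr => k _; rewrite colE -mulmxA -colE -tr_row.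
    rewrite (_ : W *m _ = \sum_j M k j *: col j W) ?creav_suml; last first.
      apply/matrixP => i l; rewrite !mxE summxE.
      by apply: eq_bigr => j _; rewrite !mxE mulrC.
    by apply: eq_bigr => j _; rewrite creavZl.
  rewrite exchange_big; apply: eq_bigr => j _ /=.
  rewrite -colE [X in _ = creav _ X]/creav linear_sum; apply: eq_bigr => k _.
  by rewrite linearZ /= mxE creav_delta.
rewrite -!big_split; apply: eq_bigr => k _ /=.
by rewrite !rho_creav linearD /= addrA !colE mulmxA.
Qed.

(** Contraction with x is an antiderivation, and it maps the 2-form to - W x: the two factors of its
    terms contribute equally, which absorbs the 1/2. *)
Lemma lef_anniv W x a : 2%:R != 0 :> K -> W^T = - W ->
  lef W (anniv x a) = anniv x (lef W a) + creav (W *m x) a.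
Proof.
move=> two_neq0 WT.
have E k : anniv x (creav (col k W) (creav (delta_mx k 0) a)) =
    ((x^T *m col k W) 0 0 *: creav (delta_mx k 0) a
     - x k 0 *: creav (col k W) a)
    + creav (col k W) (creav (delta_mx k 0) (anniv x a)).
  rewrite !anniv_creav linearB linearZ /= opprB addrA addrAC; congr (_ - _ *: _ + _).
  by rewrite -colE !mxE.
rewrite /lef linearZ /= [X in _ = _ *: X + _]linear_sum; under [in RHS]eq_bigr do rewrite /= E.
rewrite big_split scalerDr sumrB /=.
have -> : \sum_k x k 0 *: creav (col k W) a = creav (W *m x) a.
  under eq_bigr do rewrite -creavZl; rewrite -creav_suml; congr (creav _ _).
  by apply/matrixP => i j; rewrite mxE summxE; apply: eq_bigr => k _; rewrite !mxE ord1 mulrC.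
have -> : \sum_k (x^T *m col k W) 0 0 *: creav (delta_mx k 0) a = - creav (W *m x) a.
  rewrite -scaleN1r -creavZl scaleN1r -mulNmx -WT /creav.
  apply: eq_bigr => k _; rewrite -/(creav _ _) creav_delta; congr (_ *: _).
  by rewrite -[W^T *m x]trmxK trmx_mul trmxK colE mulmxA -colE !mxE.
rewrite -opprD scalerN -mulr2n -scaler_nat scalerA mulVf // scale1r.
by rewrite addrAC addNr add0r.
Qed.

Lemma lef_ltE W a : 2%:R != 0 :> K -> W^T = - W ->
  lef W a = \sum_(i : 'I_m) \sum_(j : 'I_m | (i < j)%N) W i j *: crea i (crea j a).
Proof.
move=> two_neq0 WT; have Wji (i j : 'I_m) : W j i = - W i j.
  by have := congr1 (fun M : 'M_m => M i j) WT; rewrite !mxE.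
pose F (p : 'I_m * 'I_m) := W p.1 p.2 *: crea p.1 (crea p.2 a).
have -> : lef W a = 2%:R^-1 *: \sum_p F p.
  rewrite /lef -(pair_bigA _ (fun i j => F (i, j))) exchange_big; congr (_ *: _).
  apply: eq_bigr => j _; rewrite creav_delta; apply: eq_bigr => i _.
  by rewrite mxE.
have Fsym p : F (p.2, p.1) = F p.
  by rewrite /F /= crea_anti Wji scalerN scaleNr opprK.
rewrite pair_big_dep /=.
rewrite (bigID (fun p : 'I_m * 'I_m => (p.1 < p.2)%N)) /=.
rewrite [X in _ + X](bigID (fun p : 'I_m * 'I_m => (p.1 == p.2)%N)) /=.
rewrite [X in _ + (X + _)]big1 ?add0r; last first.
  by move=> [j k] /= /andP[_ /eqP<-]; rewrite /F /= crea_sqr scaler0.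
rewrite [X in _ + X](reindex_inj (h := fun p : 'I_m * 'I_m => (p.2, p.1))) /=; last first.
  by move=> [? ?] [? ?] [-> ->].
rewrite [X in _ + X](eq_bigl (fun p : 'I_m * 'I_m => (p.1 < p.2)%N)); last first.
  by move=> [j k] /=; rewrite -leqNgt ltn_neqAle andbC eq_sym.
under [X in _ + X]eq_bigr do rewrite Fsym.
by rewrite -mulr2n -scaler_nat scalerA mulVf // scale1r.
Qed.

End Lefschetz.

(** * The Hodge star of a metric and its commutators with L and Lambda *)

Section HodgeStar.
Variables (K : fieldType) (m : nat).
Variables (G H W : 'M[K]_m) (u : K).
Hypotheses (two_neq0 : 2%:R != 0 :> K) (m_even : ~~ odd m).
Hypotheses (GT : G^T = G) (GH : G *m H = 1%:M) (u2 : u ^+ 2 * \det G = 1).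
Hypothesis (WT : W^T = - W).
Implicit Types (a b : ext K m) (x y : 'cV[K]_m).

(* The Hodge star of the Gram matrix [G]: the factor [u] is the coefficient of the
   volume form divided by the determinant of [G], because [fstar \o pb H] is
   [pb G \o fstar] up to that determinant; see [fstar_pb]. *)
Definition hstar a : ext K m := u *: pb G (fstar a).

Fact hstar_linear : linear hstar.
Proof. by move=> c a b; rewrite /hstar !linearP /=. Qed.
HB.instance Definition _ :=
  GRing.isLinear.Build K (ext K m) (ext K m) *:%R hstar hstar_linear.

Lemma parity_hstar a : parity (hstar a) = hstar (parity a).
Proof.
by rewrite /hstar linearZ /= parity_pb fstar_parity -signr_odd (negPf m_even) scale1r.
Qed.

Lemma hstar_creav x a : hstar (creav x a) = anniv (H *m x) (hstar (parity a)).
Proof.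
by rewrite /hstar fstar_creav [RHS]linearZ /= anniv_pb GT mulmxA GH mul1mx.
Qed.

Lemma hstar_anniv x a : hstar (anniv x a) = - creav (G *m x) (hstar (parity a)).
Proof.
by rewrite /hstar fstar_anniv linearN /= pb_creav scalerN [in RHS]linearZ.
Qed.

(** In degree k the sign of the squared star is (-1)^(k (m - k)), which is (-1)^k for even m. The
    normalization [u2] is what the value at 1 requires. *)
Lemma hstarK a : hstar (hstar a) = parity a.
Proof.
elim/ext_ind: a => [|c a b IHa IHb|x a IH].
- rewrite /hstar fstar_extone pb_exttop !linearZ /= fstar_exttop pb_extone.
  by rewrite !scalerA parity_extone mulrAC -expr2 u2 scale1r.
- by rewrite !linearP /= IHa IHb.
- rewrite hstar_creav hstar_anniv mulmxA GH mul1mx parity_hstar parityK.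
  by rewrite IH parity_creav.
Qed.

Lemma hstar_inj : injective hstar.
Proof. by move=> a b /(congr1 hstar); rewrite !hstarK => /(congr1 (@parity _ _)); rewrite !parityK. Qed.

Lemma hstar_conj_creav x a : hstar (creav x (hstar a)) = anniv (H *m x) a.
Proof. by rewrite hstar_creav parity_hstar hstarK parityK. Qed.

(** Since [hstarK] makes [hstar \o parity] the inverse of [hstar], this is star^-1 L star. *)
Definition lam a : ext K m := hstar (parity (lef W (hstar a))).

Fact lam_linear : linear lam.
Proof. by move=> c a b; rewrite /lam !linearP. Qed.
HB.instance Definition _ :=
  GRing.isLinear.Build K (ext K m) (ext K m) *:%R lam lam_linear.

(** Conjugation by the star turns this into [lef_creav]: contractions commute with Lambda because
    exterior multiplications commute with L. *)
Lemma lam_conj_creav x a :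
  lam (hstar (creav x (hstar a))) = hstar (creav x (hstar (lam a))).
Proof.
by rewrite /lam !hstarK -parity_lef !parityK lef_creav.
Qed.

Lemma lef_conj_creav x a :
  lef W (hstar (creav x (hstar a))) =
  hstar (creav x (hstar (lef W a))) + creav (W *m H *m x) a.
Proof. by rewrite !hstar_conj_creav lef_anniv // mulmxA. Qed.

(** This is [lef_conj_creav] at [hstar a], transported by the star. For W = J G and H the inverse of
    G, [W *m H] is J. *)
Lemma lam_creav x a :
  lam (creav x a) = creav x (lam a) - hstar (creav (W *m H *m x) (hstar a)).
Proof.
have := lef_conj_creav x (hstar a); rewrite hstarK.
have -> : creav x (parity a) = - parity (creav x a) by rewrite parity_creav opprK.
rewrite linearN /= -parity_hstar linearN /= -parity_lef.
move=> /(congr1 (fun c => hstar (- c))); rewrite opprK -/(lam (creav x a)) => ->.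
rewrite linearN linearD opprD /= hstarK parity_creav opprK; congr (creav _ _ - _).
by rewrite parity_hstar.
Qed.

(* The value at a point of an operator \sum_k (col k P) /\ nabla_k, in terms of
   the covariant derivatives [N k] of its argument. *)
Definition symb (P : 'M[K]_m) (N : 'I_m -> ext K m) : ext K m :=
  \sum_k creav (col k P) (N k).

Lemma lef_symb P N : lef W (symb P N) = symb P (fun k => lef W (N k)).
Proof. by rewrite linear_sum; apply: eq_bigr => k _ /=; rewrite lef_creav. Qed.

Lemma hstar_symb_hstar P N :
  hstar (symb P (fun k => hstar (N k))) = \sum_k hstar (creav (col k P) (hstar (N k))).
Proof. by rewrite linear_sum. Qed.

Lemma lam_hstar_symb P N :
  lam (hstar (symb P (fun k => hstar (N k)))) =
  hstar (symb P (fun k => hstar (lam (N k)))).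
Proof.
rewrite hstar_symb_hstar (hstar_symb_hstar P (fun k => lam (N k))) linear_sum.
by apply: eq_bigr => k _; rewrite /= lam_conj_creav.
Qed.

Variables (P : 'M[K]_m) (c : K) (JP : W *m H *m P = c *: P).

(** In the applications P projects onto the covectors of type (1,0) or (0,1), on which J = [W *m H]
    is the scalar c = i or - i; hence the extra term of [lam_creav] is again built on the symbol of
    P. *)
Lemma lam_symb N :
  lam (symb P N) =
  symb P (fun k => lam (N k)) - c *: hstar (symb P (fun k => hstar (N k))).
Proof.
rewrite linear_sum hstar_symb_hstar scaler_sumr -sumrB; apply: eq_bigr => k _ /=.
rewrite lam_creav; congr (_ - _).
by rewrite colE mulmxA JP -scalemxAl creavZl (linearZ_LR hstar).
Qed.

Lemma lef_hstar_symb N :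
  lef W (hstar (symb P (fun k => hstar (N k)))) =
  hstar (symb P (fun k => hstar (lef W (N k)))) + c *: symb P N.
Proof.
rewrite hstar_symb_hstar (hstar_symb_hstar P (fun k => lef W (N k))) linear_sum.
rewrite scaler_sumr -big_split; apply: eq_bigr => k _ /=.
rewrite lef_conj_creav; congr (_ + _).
by rewrite colE mulmxA JP -scalemxAl creavZl.
Qed.

End HodgeStar.

(** * The Levi-Civita connection at a point *)

Section Connection.
Variables (K : fieldType) (m : nat).
Hypothesis two_neq0 : 2%:R != 0 :> K.
Implicit Types (i j k l : 'I_m) (a b : ext K m).
Local Notation extone := (extb K (@set0 'I_m)).

(** [W k] plays the derivative of the matrix of omega along e_k. Contracting d omega successively
    with e_i, e_j and e_l leaves a scalar, read off at the empty set. *)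
Lemma cyclic_closed (W : 'I_m -> 'M[K]_m) i j l :
  (forall k, (W k)^T = - W k) ->
  \sum_k creav (delta_mx k 0) (lef (W k) extone) = 0 ->
  W i j l + W j l i + W l i j = 0.
Proof.
move=> WT dW.
have WN k p q : W k p q = - W k q p.
  by have := congr1 (fun M : 'M_m => M q p) (WT k); rewrite !mxE.
have annilef k (x : 'cV_m) : anniv x (lef (W k) extone) = - creav (W k *m x) extone.
  apply/eqP; rewrite -addr_eq0 -lef_anniv //.
  by rewrite anniv_extone linear0.
have dE k p : ((delta_mx p 0 : 'cV[K]_m)^T *m delta_mx k 0) 0 0 = (p == k)%:R.
  by rewrite trmx_delta -rowE !mxE eqxx andbT.
have pick (F : 'I_m -> ext K m) p : \sum_k (p == k)%:R *: F k = F p.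
  rewrite (bigD1 p) //= eqxx scale1r big1 ?addr0 // => k kp.
  by rewrite eq_sym (negPf kp) scale0r.
have e1 : lef (W i) extone +
    \sum_k creav (delta_mx k 0) (creav (W k *m delta_mx i 0) extone) = 0.
  have := congr1 (anniv (delta_mx i 0)) dW; rewrite linear0 linear_sum => e; rewrite -[RHS]e.
  rewrite -[lef (W i) _](pick (fun k => lef (W k) extone)) -big_split.
  by apply: eq_bigr => k _ /=; rewrite anniv_creav annilef dE linearN opprK.
have e2 : - creav (W i *m delta_mx j 0) extone + creav (W j *m delta_mx i 0) extone
    - \sum_k W k j i *: creav (delta_mx k 0) extone = 0.
  have := congr1 (anniv (delta_mx j 0)) e1.
  rewrite linear0 linearD /= annilef [X in _ + X = _]linear_sum => e.
  rewrite -[RHS]e -addrA; congr (_ + _).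
  rewrite -[creav (W j *m _) _](pick (fun k => creav (W k *m delta_mx i 0) extone)).
  rewrite -sumrN -big_split; apply: eq_bigr => k _ /=.
  rewrite !anniv_creav dE anniv_extone linear0 subr0 [creav _ (_ *: _)]linearZ /=; congr (_ - _ *: _).
  by rewrite -colE trmx_delta -rowE !mxE.
have := congr1 (anniv (delta_mx l 0)) e2.
rewrite linear0 !linearD !linearN [X in _ - X = _]linear_sum /=.
rewrite !anniv_creav !anniv_extone !linear0 !addr0.
under eq_bigr do
  rewrite linearZ /= anniv_creav dE anniv_extone linear0 subr0 scalerA mulrC -scalerA.
rewrite pick -!colE !trmx_delta -!rowE !mxE -scaleNr -scalerDl -scalerBl.
move=> /(congr1 (fun a : ext K m => a set0)); rewrite !ffunE eqxx => /eqP.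
rewrite scale_regE mulr1 => /eqP; rewrite -WN => <-.
by rewrite [W l i j]WN.
Qed.

(** The symmetric pair of indices (k, j) is summed against the antisymmetric dx_k /\ dx_j, so the
    sum equals its opposite. *)
Lemma torsion_free (N : 'I_m -> 'M[K]_m) a :
  (forall k i j, N k i j = N i k j) -> \sum_k crea k (rho (N k) a) = 0.
Proof.
move=> Nsym; set s := LHS.
have sE : s = \sum_l \sum_k \sum_j N k j l *: crea k (crea j (anni l a)).
  rewrite exchange_big; apply: eq_bigr => k _; rewrite linear_sum.
  apply: eq_bigr => l _; rewrite linear_sum; apply: eq_bigr => j _.
  by rewrite linearZ /= mxE.
suff s2 : s = - s.
  have : 2%:R *: s = 0 by rewrite scaler_nat mulr2n {2}s2 subrr.
  by move/eqP; rewrite scaler_eq0 (negPf two_neq0) => /eqP.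
rewrite {1}sE sE -sumrN; apply: eq_bigr => l _.
rewrite [LHS]exchange_big -sumrN; apply: eq_bigr => k _ /=.
rewrite -sumrN; apply: eq_bigr => j _.
by rewrite crea_anti scalerN Nsym.
Qed.

End Connection.

(** * Compatibility of the Levi-Civita connection with the metric and with J *)

Section LeviCivita.
Variables (K : fieldType) (m : nat).
Hypothesis two_neq0 : 2%:R != 0 :> K.
Implicit Types (a b k l : 'I_m).
(** [T k] stands for the derivative of G along e_k. As omega has matrix J G, [T_closed] says that d
    omega = 0. *)
Variables (G H J : 'M[K]_m) (T : 'I_m -> 'M[K]_m).
Hypotheses (GT : G^T = G) (GH : G *m H = 1%:M).
Hypotheses (JT : J^T = - J) (JJ : J *m J = - 1%:M) (JG : J *m G = G *m J).
Hypotheses (TT : forall k, (T k)^T = T k) (JTk : forall k, J *m T k = T k *m J).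
Hypothesis T_closed : forall i j l,
  (J *m T i) j l + (J *m T j) l i + (J *m T l) i j = 0.

(* The Christoffel symbols of the first kind of the Levi-Civita connection. *)
Definition christoffel k : 'M[K]_m :=
  \matrix_(a, b) (2%:R^-1 * (T k a b + T a k b - T b k a)).
Definition levi_civita k : 'M[K]_m := christoffel k *m H.

Let T_sym k a b : T k a b = T k b a.
Proof. by have := congr1 (fun M : 'M_m => M b a) (TT k); rewrite mxE. Qed.

Lemma levi_civita_metric k : levi_civita k *m G + G *m (levi_civita k)^T = T k.
Proof.
have HG := mulmx1C GH.
have HT : H^T = H.
  have : G *m H^T = 1%:M by rewrite -{1}GT -trmx_mul HG trmx1.
  by move=> /(congr1 (mulmx H)); rewrite mulmxA HG mul1mx mulmx1.
rewrite /levi_civita trmx_mul HT mulmxA GH mul1mx -mulmxA HG mulmx1.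
by apply/matrixP => a b; rewrite !mxE [T k b a]T_sym; field.
Qed.

Lemma levi_civita_sym k a b : levi_civita k a b = levi_civita a k b.
Proof.
rewrite !mxE; apply: eq_bigr => l _; rewrite !mxE [T l a k]T_sym.
by rewrite [T a k l + _]addrC.
Qed.

(** The derivative of the entry G k b along J e_a, the row a of J. *)
Let P a k b := \sum_l J a l * T l k b.

Let JTanti k a b : (J *m T k) a b = - (J *m T k) b a.
Proof.
have e : (J *m T k)^T = - (J *m T k) by rewrite trmx_mul JT TT mulmxN JTk.
by have := congr1 (fun M : 'M_m => M b a) e; rewrite mxE => ->; rewrite mxE.
Qed.

(** This is d omega (J e_a, J e_k, e_b) = 0, simplified by J^2 = -1 and the J-invariance of each
    T. *)
Let T_closed_J a k b : P a k b + (J *m T b) k a = P k a b.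
Proof.
have TE l : T l k b = - \sum_r J k r * (J *m T l) r b.
  have {1}-> : T l = - (J *m (J *m T l)) by rewrite mulmxA JJ mulNmx mul1mx opprK.
  by rewrite mxE mxE.
have PE : P a k b = \sum_l \sum_r J a l * J k r * ((J *m T r) b l + (J *m T b) l r).
  apply: eq_bigr => l _; rewrite TE mulrN mulr_sumr -sumrN.
  apply: eq_bigr => r _; rewrite -mulrA -mulrN -mulrN; congr (_ * (_ * _)).
  by apply/esym/eqP; rewrite -subr_eq0 opprK addrC addrA T_closed.
rewrite PE; under eq_bigr do under eq_bigr do rewrite mulrDr.
under eq_bigr do rewrite big_split; rewrite big_split /= -addrA.
rewrite [X in _ + (X + _)](_ : _ = - (J *m T b) k a) ?addNr ?addr0; last first.
  rewrite -JTanti -[LHS](_ : (J *m (J *m T b) *m J^T) a k = _).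
    by rewrite JT mulmxN mulmxA JJ !mulNmx mul1mx opprK JTk.
  rewrite mxE exchange_big; apply: eq_bigr => r _; rewrite mxE mulr_suml.
  by apply: eq_bigr => l _; rewrite [J^T _ _]mxE mulrAC.
rewrite exchange_big; apply: eq_bigr => r _.
under eq_bigr do rewrite [J a _ * _]mulrC -mulrA; rewrite -mulr_sumr; congr (_ * _).
rewrite -[LHS](_ : (J *m T r *m J^T) b a = _); last first.
  by rewrite mxE; apply: eq_bigr => l _; rewrite [J^T _ _]mxE mulrC.
by rewrite JT mulmxN -mulmxA -JTk mulmxA JJ mulNmx mul1mx opprK T_sym.
Qed.

(** That is, nabla J = 0. H commutes with J; without the factor H, [T_closed_J] turns the (a, b)
    entries of the two sides into half of (J T_k) a b plus P k a b, respectively P k b a, and P is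
    symmetric in its last two indices. *)
Lemma levi_civita_J k : levi_civita k *m J = J *m levi_civita k.
Proof.
have HG := mulmx1C GH.
have JH : J *m H = H *m J.
  transitivity (H *m (G *m J) *m H); first by rewrite mulmxA HG mul1mx.
  by rewrite -JG -!mulmxA GH mulmx1.
rewrite /levi_civita -mulmxA -JH !mulmxA; congr (_ *m H); apply/matrixP => a b.
have -> : (J *m christoffel k) a b =
    2%:R^-1 * ((J *m T k) a b + (P a k b + (J *m T b) k a)).
  rewrite [(J *m T b) k a]JTanti !mxE /P -sumrN -!big_split mulr_sumr; apply: eq_bigr => l _ /=.
  by rewrite !mxE [T b l k]T_sym; ring.
have -> : (christoffel k *m J) a b =
    2%:R^-1 * ((J *m T k) a b + (P b k a + (J *m T a) k b)).
  rewrite !JTk !mxE /P -!big_split mulr_sumr; apply: eq_bigr => l _ /=.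
  have -> : J b l = - J l b.
    by have := congr1 (fun M : 'M_m => M l b) JT; rewrite !mxE.
  by rewrite !mxE; ring.
by rewrite !T_closed_J; congr (_ * (_ + _)); apply: eq_bigr => l _; rewrite T_sym.
Qed.

End LeviCivita.

Local Open Scope complex_scope.

(** * The operators on complex covectors *)

Section Covectors.
Variables (R : realType) (n : nat).
Local Notation C := (R[i] : fieldType).
Local Notation ext := (ext C (n + n)).
Local Notation extb := (extb C).
Local Notation cplx := (map_mx (real_complex R)).
Implicit Types (a b c : ext) (A B : {set 'I_(n + n)}) (k : 'I_(n + n)).

Lemma scalecvE (z : C) a : scalecv z a = z *: a.
Proof. by apply/ffunP => A; rewrite !ffunE. Qed.

Lemma shuffle_signE A B : shuffle_sign R A B = shs C A B.
Proof. by []. Qed.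

Lemma wedge_extone c : wedge (extb set0) c = c.
Proof.
apply/ffunP => A; rewrite ffunE (bigD1 set0) ?sub0set //= big1 ?addr0.
  by rewrite ffunE eqxx mulr1 setD0 shuffle_signE shsE big_set0 mul1r.
by move=> B /andP[_ /negPf B0]; rewrite ffunE B0 mulr0 mul0r.
Qed.

Lemma wedge_crea k b c : wedge (crea k b) c = crea k (wedge b c : ext).
Proof.
apply/ffunP => A; rewrite !ffunE.
rewrite (bigID (fun B : {set 'I_(n + n)} => k \in B)) /= [X in _ + X]big1 ?addr0; last first.
  by move=> B /andP[_ /negPf kB]; rewrite ffunE kB mulr0 mul0r.
have [kA|kA] := ifPn; last first.
  by rewrite big1 // => B /andP[/fintype.subsetP sBA /sBA]; rewrite (negPf kA).
rewrite mulr_sumr (reindex_onto (fun B : {set 'I_(n + n)} => k |: B)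
  (fun B : {set 'I_(n + n)} => (B :\ k))) /=; last first.
  by move=> B /andP[_ kB]; rewrite setD1K.
apply: eq_big => [B|B /andP[/andP[skBA kkB] /eqP eB]].
  rewrite setU11 andbT subUset sub1set kA /= subsetD1.
  congr (_ && _); apply/eqP/idP => [<-|kB]; first by rewrite setD11.
  by rewrite setU1K.
have kB : k \notin B by rewrite -eB setD11.
have -> : A :\: (k |: B) = (A :\ k) :\: B by rewrite setDDl.
set D := _ :\: B.
rewrite !shuffle_signE shsU1l // ffunE setU11 setU1K //.
have -> : sgn C k A = sgn C k B * sgn C k D.
  have sBA : B \subset A := subset_trans (subsetUr _ _) skBA.
  rewrite !sgnE (big_setID B) /= (setIidPr sBA) (big_setD1 k (A := A :\: B)) ?inE ?kB //=.
  by rewrite ltnn mul1r /D setDDl setUC -setDDl.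
by rewrite sgnU1 // ltnn mul1r mulrACA [sgn C k D * _]mulrC -!mulrA.
Qed.

Lemma wedge_dx k a : wedge (dx R k) a = crea k a.
Proof.
rewrite -[in RHS](wedge_extone a) -wedge_crea crea_extb inE; congr (wedge _ a).
rewrite /sgn (_ : [set _ in _ | _] = set0) ?cards0 ?scale1r ?setU0 //.
by apply/setP => i; rewrite !inE.
Qed.

Lemma minor_map (P : 'M[R]_(n + n)) A B :
  minor (cplx P) A B = (minor P A B)%:C.
Proof.
rewrite /minor; case: ifP => // _; rewrite -det_map_mx; congr (\det _).
by apply/matrixP => i j; rewrite !mxE.
Qed.

(** The sign comes from sorting dx_1 dy_1 ... dx_n dy_n into the order of the indices; what matters
    is that it is the same for all G. *)
Lemma vol_sign : exists s : nat, forall G : 'M[R]_(n + n),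
  vol G setT = (-1) ^+ s * (Num.sqrt (\det G))%:C.
Proof.
pose v (r : seq 'I_n) : ext := \big[@wedge R n/dxset R set0]_(k <- r)
       wedge (dx R (xcoord k)) (dx R (ycoord k)).
pose S (r : seq 'I_n) := [set j | (j \in map (@xcoord n) r) || (j \in map (@ycoord n) r)].
have vE r : uniq r -> exists s : nat, v r = (-1) ^+ s *: extb (S r).
  elim: r => [_|k r IH /= /andP[kr /IH[s vr]]].
    exists 0%N; rewrite scale1r /v big_nil (_ : S [::] = set0) //.
  have xr : xcoord k \notin ycoord k |: S r.
    rewrite !inE eq_lrshift mem_map; last exact: lshift_inj.
    rewrite (negPf kr) /=; apply/mapP => -[l _ /eqP].
    by rewrite eq_lrshift.
  have yr : ycoord k \notin S r.
    rewrite !inE [in X in _ || X]mem_map; last exact: rshift_inj.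
    rewrite (negPf kr) orbF /=; apply/mapP => -[l _ /eqP].
    by rewrite eq_rlshift.
  rewrite /v big_cons -/(v r) wedge_dx wedge_crea wedge_dx vr linearZ /= crea_extb.
  rewrite (negPf yr) !linearZ /= crea_extb (negPf xr) !scalerA -!exprD.
  eexists; congr (_ *: extb _).
  by apply/setP => j; rewrite !inE; case: (j == xcoord k); rewrite ?orbT //= orbCA.
have [s vs] := vE _ (index_enum_uniq _).
exists s => G; rewrite /vol ffunE -/(v _) vs mulrC; congr (_ * _).
rewrite !ffunE scale_regE.
rewrite (_ : _ == _ = true) ?mulr1 //; apply/eqP/setP => j; rewrite !inE.
case: (split_ordP j) => k ->; rewrite ?(mem_map (@lshift_inj _ _)) ?(mem_map (@rshift_inj _ _));
  by rewrite mem_index_enum ?orbT.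
Qed.

(** The conjugations in [star] and [covec_prod] cancel, leaving the volume coefficient times the
    flat star of the pull-back by G^-1. Moving the pull-back across by [fstar_pb] divides by det G,
    and sqrt (det G) / det G is 1 / sqrt (det G). *)
Lemma star_hstar : exists s : nat, forall (G : 'M[R]_(n + n)) b,
  G^T = G -> 0 < \det G ->
  star G b = hstar (cplx G) ((-1) ^+ s * ((Num.sqrt (\det G))^-1)%:C) b.
Proof.
have [s vs] := vol_sign; exists s => G b GT Gpos.
have Gu : G \in unitmx by rewrite unitmxE unitfE gt_eqF.
have GG : cplx (invmx G) *m cplx G = 1%:M by rewrite -map_mxM mulVmx // map_mx1.
have -> : star G b = vol G setT *: fstar (pb (cplx (invmx G)) b).
  apply/ffunP => B; rewrite [LHS]ffunE [RHS]ffunE [fstar _ _]ffunE scale_regE.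
  rewrite mulrCA; congr (_ * _).
  rewrite rmorphM /= mulrC; congr (_ * _).
    by rewrite vs rmorphM rmorphXn rmorphN1; congr (_ * _); exact: conjc_real.
  rewrite /covec_prod (bigD1 (~: B)) //= [X in _ + X]big1 ?addr0; last first.
    by move=> A /negPf neA; rewrite big1 // => D _; rewrite ffunE neA !mul0r.
  rewrite rmorph_sum [RHS]ffunE; apply: eq_bigr => D _.
  rewrite ffunE eqxx mul1r rmorphM /= conjcK minor_map; congr (_ * _).
  exact: conjc_real.
rewrite (fstar_pb _ GG) scalerA vs map_trmx GT det_map_mx det_inv /hstar.
rewrite -mulrA -rmorphM; congr (_ * _%:C *: _).
have s0 : Num.sqrt (\det G) != 0 by rewrite sqrtr_eq0 -ltNge.
rewrite -[X in _ / X](sqr_sqrtr (ltW Gpos)).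
by rewrite expr2 invfM mulrA divff // mul1r.
Qed.

Lemma wedgeZl z b c : wedge (scalecv z b) c = z *: (wedge b c : ext).
Proof.
apply/ffunP => A; rewrite !ffunE scale_regE mulr_sumr.
by apply: eq_bigr => B _; rewrite ffunE mulrCA !mulrA.
Qed.

Lemma wedge_suml (I : Type) (r : seq I) (Q : pred I) (F : I -> covec R n) c :
  wedge (\sum_(i <- r | Q i) F i) c = \sum_(i <- r | Q i) wedge (F i) c.
Proof.
apply: (big_morph (fun b : covec R n => wedge b c)) => [a b|]; apply/ffunP => A.
  rewrite !ffunE -big_split; apply: eq_bigr => B _.
  by rewrite !ffunE mulrDr mulrDl.
by rewrite !ffunE big1 // => B _; rewrite ffunE mulr0 mul0r.
Qed.

Lemma wedge_fundamental (G : 'M[R]_(n + n)) a :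
  (Jmx R n *m G)^T = - (Jmx R n *m G) ->
  wedge (fundamental_form G) a = lef (cplx (Jmx R n *m G)) a.
Proof.
move=> WT.
rewrite lef_ltE ?pnatr_eq0 //; last by rewrite map_trmx WT map_mxN.
rewrite /fundamental_form wedge_suml; apply: eq_bigr => i _.
rewrite wedge_suml; apply: eq_bigr => j _.
rewrite wedgeZl wedge_dx wedge_crea wedge_dx; congr (_ *: _).
by rewrite mxE /gprod /basis_vec trmx_delta -colE -rowE -row_mul !mxE.
Qed.

End Covectors.

(** * Decomposition by type *)

Section Types.
Variables (R : realType) (n : nat).
Local Notation C := (R[i] : fieldType).
Local Notation ext := (ext C (n + n)).
Local Notation extb := (extb C).
Local Notation Z := (Zframe R n).
Implicit Types (a b c : ext) (A B : {set 'I_(n + n)}) (i j k : 'I_(n + n)).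
Implicit Types (p q : nat) (x : 'cV[C]_(n + n)).

Definition xdeg A := #|[pred k : 'I_n | xcoord k \in A]|.
Definition ydeg A := #|[pred k : 'I_n | ycoord k \in A]|.

Lemma xdegU1 j A : j \notin A -> xdeg (j |: A) = ((j < n)%N + xdeg A)%N.
Proof.
case: (split_ordP j) => k -> kA; rewrite /xdeg /=.
  rewrite (cardD1 k) inE setU11; congr (_ + _)%N; apply: eq_card => l.
  rewrite !inE (inj_eq (@lshift_inj _ _)); case: eqVneq => //= ->.
  by apply/esym/negbTE.
apply: eq_card => l.
by rewrite !inE eq_lrshift.
Qed.

Lemma ydegU1 j A : j \notin A -> ydeg (j |: A) = ((n <= j)%N + ydeg A)%N.
Proof.
rewrite leqNgt; case: (split_ordP j) => k -> kA; rewrite /ydeg /=.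
  apply: eq_card => l.
  by rewrite !inE eq_rlshift.
rewrite (cardD1 k) inE setU11; congr (_ + _)%N; apply: eq_card => l.
rewrite !inE (inj_eq (@rshift_inj _ _)); case: eqVneq => //= ->.
by apply/esym/negbTE.
Qed.

Definition tmask p q a : ext :=
  [ffun A : {set 'I_(n + n)} => if (xdeg A == p) && (ydeg A == q) then a A else 0].

Fact tmask_linear p q : linear (tmask p q).
Proof.
move=> c a b; apply/ffunP => A; rewrite !ffunE.
by case: ifP => _ //; rewrite scaler0 addr0.
Qed.
HB.instance Definition _ p q :=
  GRing.isLinear.Build C ext ext *:%R (tmask p q) (tmask_linear p q).

Lemma sum_tmask a : \sum_(p < n.+1) \sum_(q < n.+1) tmask p q a = a.
Proof.
apply/ffunP => A; rewrite sum_ffunE.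
have xA : (xdeg A < n.+1)%N by rewrite ltnS -[leqRHS]card_ord max_card.
have yA : (ydeg A < n.+1)%N by rewrite ltnS -[leqRHS]card_ord max_card.
rewrite (bigD1 (Ordinal xA)) //= [X in _ + X]big1 ?addr0; last first.
  move=> p /eqP pA; rewrite sum_ffunE big1 // => q _; rewrite ffunE.
  by case: ifP => // /andP[/eqP e]; case: pA; apply/val_inj.
rewrite sum_ffunE (bigD1 (Ordinal yA)) //= [X in _ + X]big1 ?addr0; last first.
  move=> q /eqP qA; rewrite ffunE.
  by case: ifP => // /andP[_ /eqP e]; case: qA; apply/val_inj.
by rewrite ffunE !eqxx.
Qed.

(** In the frame Z an index j < n is a dz and raises the first degree, the others raise the second
    one; so the mask (p + 1, q) keeps the former only. *)
Lemma tmask_crea_x p q j a :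
  tmask p.+1 q (crea j (tmask p q a)) = ((j < n)%N%:R : C) *: crea j (tmask p q a).
Proof.
apply/ffunP => A; rewrite !ffunE scale_regE.
have [jA|] := boolP (j \in A); last by rewrite mulr0 if_same.
have jN : j \notin A :\ j by rewrite setD11.
rewrite -[in xdeg A](setD1K jA) -[in ydeg A](setD1K jA) xdegU1 // ydegU1 //.
rewrite [(n <= j)%N]leqNgt; case: (j < n)%N; rewrite /= ?mul1r ?mul0r ?add0n ?add1n ?eqSS.
  by case: ifP => c; rewrite ?c ?mulr0 ?if_same.
case: ifP => // /andP[/eqP -> _]; case: ifP => // [/andP[/eqP e _]|_]; last by rewrite mulr0.
by have := ltnn p; rewrite -[X in (_ < X)%N]e ltnSn.
Qed.

Lemma tmask_crea_y p q j a :
  tmask p q.+1 (crea j (tmask p q a)) = ((n <= j)%N%:R : C) *: crea j (tmask p q a).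
Proof.
apply/ffunP => A; rewrite !ffunE scale_regE.
have [jA|] := boolP (j \in A); last by rewrite mulr0 if_same.
have jN : j \notin A :\ j by rewrite setD11.
rewrite -[in xdeg A](setD1K jA) -[in ydeg A](setD1K jA) xdegU1 // ydegU1 //.
rewrite [(n <= j)%N]leqNgt; case: (j < n)%N; rewrite /= ?mul1r ?mul0r ?add0n ?add1n ?eqSS.
  case: ifP => // /andP[_ /eqP ->]; case: ifP => // [/andP[_ /eqP e]|_]; last by rewrite mulr0.
  by have := ltnn q; rewrite -[X in (_ < X)%N]e ltnSn.
by case: ifP => c; rewrite ?c ?mulr0 ?if_same.
Qed.

Definition Xproj : 'M[C]_(n + n) := block_mx 1%:M 0 0 0.
Definition Yproj : 'M[C]_(n + n) := block_mx 0 0 0 1%:M.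

Lemma XprojE x j : (Xproj *m x) j 0 = (j < n)%N%:R * x j 0.
Proof.
rewrite -[x]vsubmxK mul_block_col !(mul1mx, mul0mx, addr0).
case: (split_ordP j) => k ->; rewrite ?col_mxEu ?col_mxEd /=.
  by rewrite mul1r.
by rewrite mul0r mxE.
Qed.

Lemma YprojE x j : (Yproj *m x) j 0 = (n <= j)%N%:R * x j 0.
Proof.
rewrite -[x]vsubmxK mul_block_col !(mul1mx, mul0mx, add0r).
rewrite leqNgt; case: (split_ordP j) => k ->; rewrite ?col_mxEu ?col_mxEd /=.
  by rewrite mul0r mxE.
by rewrite mul1r.
Qed.

Lemma tmask_creav_x p q x a :
  tmask p.+1 q (creav x (tmask p q a)) = creav (Xproj *m x) (tmask p q a).
Proof.
rewrite linear_sum; apply: eq_bigr => j _.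
by rewrite linearZ /= tmask_crea_x scalerA XprojE mulrC.
Qed.

Lemma tmask_creav_y p q x a :
  tmask p q.+1 (creav x (tmask p q a)) = creav (Yproj *m x) (tmask p q a).
Proof.
rewrite linear_sum; apply: eq_bigr => j _.
by rewrite linearZ /= tmask_crea_y scalerA YprojE mulrC.
Qed.

(** A block diagonal N replaces each dz by dz's and each dzbar by dzbar's, so both degrees are
    kept. *)
Lemma tmask_rho p q (N : 'M[C]_(n + n)) a :
  (forall i j, (i < n)%N != (j < n)%N -> N i j = 0) ->
  tmask p q (rho N a) = rho N (tmask p q a).
Proof.
move=> N0; rewrite /rho linear_sum; apply: eq_bigr => j _ /=.
rewrite linear_sum; apply: eq_bigr => i _; rewrite linearZ /= mxE.
have [ij|/N0->] := eqVneq (i < n)%N (j < n)%N; last by rewrite !scale0r.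
congr (_ *: _); apply/ffunP => A; rewrite !ffunE.
have [iA|] := boolP (i \in A); last by rewrite if_same.
have [jA|jA] := boolP (j \in A :\ i); first by rewrite mulr0 if_same.
have iN : i \notin A :\ i by rewrite setD11.
rewrite -[in xdeg A](setD1K iA) -[in ydeg A](setD1K iA) !xdegU1 // !ydegU1 //.
by rewrite ![(n <= _)%N]leqNgt ij; case: ifP => //; rewrite !mulr0.
Qed.

Lemma Zframe_unit : Z \in unitmx.
Proof.
(* The inverse comes from d/dx = d/dz + d/dzbar and d/dy = i (d/dz - d/dzbar). *)
suff : Z *m block_mx 1%:M 1%:M ('i%C)%:M (- 'i%C)%:M = 1%:M by move/mulmx1_unit=> [].
have two0 : 2%:R != 0 :> C by rewrite pnatr_eq0.
rewrite /Zframe -scalemxAl mulmx_block !mul1mx -!scalar_mxM -!raddfD /=.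
rewrite mulrNN mulNr !mulrN -!expr2 sqr_i ?opprK subrr raddf0 -scalar_mx_block.
by rewrite scale_scalar_mx mulVf.
Qed.

Definition Dmx : 'M[C]_(n + n) := block_mx ('i%C)%:M 0 0 (- 'i%C)%:M.

Lemma Dmx_tr : Dmx^T = Dmx.
Proof. by rewrite /Dmx tr_block_mx !tr_scalar_mx !trmx0. Qed.

Lemma DmxE p (x : 'M[C]_(n + n, p)) j l :
  (Dmx *m x) j l = (if (j < n)%N then 'i%C else - 'i%C) * x j l.
Proof.
rewrite -[x]vsubmxK mul_block_col !(mul0mx, add0r, addr0) !mul_scalar_mx.
by case: (split_ordP j) => k ->; rewrite ?col_mxEu ?col_mxEd mxE.
Qed.

Lemma Zframe_J : Z *m map_mx (real_complex R) (Jmx R n) = Dmx *m Z.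
Proof.
rewrite /Zframe -scalemxAl -scalemxAr; congr (_ *: _).
rewrite (map_block_mx (real_complex R)) !mulmx_block map_mxN !map_mx0 map_mx1.
rewrite !(mulmx0, mulmxN, mulmx1, mul1mx, mul0mx, addr0, add0r).
by rewrite -!scalar_mxM mulrN mulNr -expr2 sqr_i !opprK -!raddfN /= !opprK.
Qed.

(** Column k is the (1,0) part of dx_k, in the coordinates dx_1, ..., dx_2n. *)
Definition hol_proj := invmx Z *m Xproj *m Z.
Definition antihol_proj := invmx Z *m Yproj *m Z.

Local Notation J := (map_mx (real_complex R) (Jmx R n)).

Lemma J_invZ : J *m invmx Z = invmx Z *m Dmx.
Proof.
apply: (can_inj (mulKmx Zframe_unit)).
by rewrite mulmxA Zframe_J -mulmxA mulmxV ?Zframe_unit // mulmx1 mulKVmx ?Zframe_unit.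
Qed.

Lemma J_hol_proj : J *m hol_proj = 'i%C *: hol_proj.
Proof.
have DX : Dmx *m Xproj = ('i%C) *: Xproj.
  rewrite /Dmx /Xproj mulmx_block scale_block_mx.
  by rewrite !(mulmx0, mulmx1, mul0mx, addr0, scaler0) scalemx1.
rewrite /hol_proj !mulmxA J_invZ -[_ *m Dmx *m _]mulmxA DX.
by rewrite -[invmx Z *m (_ *: _)]scalemxAr -scalemxAl.
Qed.

Lemma J_antihol_proj : J *m antihol_proj = - 'i%C *: antihol_proj.
Proof.
have DX : Dmx *m Yproj = (- 'i%C) *: Yproj.
  rewrite /Dmx /Yproj mulmx_block scale_block_mx.
  by rewrite !(mulmx0, mulmx1, mul0mx, add0r, scaler0) scalemx1.
rewrite /antihol_proj !mulmxA J_invZ -[_ *m Dmx *m _]mulmxA DX.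
by rewrite -[invmx Z *m (_ *: _)]scalemxAr -scalemxAl.
Qed.

Lemma type_projE p q a : type_proj p q a = pb (invmx Z) (tmask p q (pb Z a)).
Proof. by []. Qed.

Fact type_proj_linear p q : linear (type_proj p q : ext -> ext).
Proof. by move=> z a b; rewrite !type_projE !linearP. Qed.
HB.instance Definition _ p q :=
  GRing.isLinear.Build C ext ext *:%R (type_proj p q : ext -> ext) (type_proj_linear p q).

(** In the frame Z, J is diagonal with entries i and - i. A matrix commuting with it has no entry
    between the two eigenspaces, because i differs from - i, so [tmask_rho] applies. *)
Lemma type_proj_rho p q (N : 'M[C]_(n + n)) a :
  N *m J = J *m N ->
  type_proj p q (rho N a : ext) = rho N (type_proj p q a : ext).
Proof.
move=> NJ; pose M := Z *m N *m invmx Z.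
have ZN : Z *m N = M *m Z by rewrite /M mulmxKV ?Zframe_unit.
have MD : M *m Dmx = Dmx *m M.
  apply: (can_inj (mulmxK Zframe_unit)).
  rewrite -[LHS]mulmxA -Zframe_J mulmxA -ZN -[RHS]mulmxA -ZN [RHS]mulmxA -Zframe_J.
  by rewrite -!mulmxA NJ.
rewrite !type_projE (pb_rho _ ZN) tmask_rho ?(pb_rho (N := N)) //.
  by rewrite /M mulmxA mulKmx ?Zframe_unit.
move=> i j ij.
have Mij : (M *m Dmx) i j = (if (j < n)%N then 'i%C else - 'i%C) * M i j.
  by rewrite -[M *m Dmx]trmxK trmx_mul Dmx_tr mxE DmxE mxE.
have := DmxE M i j.
rewrite -MD Mij => /eqP; rewrite -subr_eq0 -mulrBl mulf_eq0 => /orP[|/eqP //].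
have i2 : 'i%C + 'i%C != 0 :> R[i] by rewrite -mulr2n mulrn_eq0 /= neq0Ci.
move: ij; case: (i < n)%N; case: (j < n)%N => //= _; rewrite ?opprK ?(negPf i2) //.
by rewrite -opprD oppr_eq0 (negPf i2).
Qed.

Lemma sum_type_proj a :
  a = \sum_(p < n.+1) \sum_(q < n.+1) pb (invmx Z) (tmask p q (pb Z a)).
Proof.
rewrite -[LHS]pb1 -(mulVmx Zframe_unit) -pb_mul -[in LHS](sum_tmask (pb Z a)).
by rewrite linear_sum; apply: eq_bigr => p _; rewrite linear_sum.
Qed.

(** On a component of type (p, q), projecting to (p + 1, q) keeps the (1,0) part of the exterior
    factor. The components then add up to the whole form, which removes the types from the formula
    for [del]. *)
Lemma sum_type_proj_x (c : 'I_(n + n) -> ext) :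
  \sum_(p < n.+1) \sum_(q < n.+1)
    type_proj p.+1 q (\sum_k crea k (type_proj p q (c k) : ext)) =
  \sum_k creav (col k hol_proj) (c k).
Proof.
transitivity (\sum_(p < n.+1) \sum_(q < n.+1) \sum_k
    pb (invmx Z) (creav (Xproj *m col k Z) (tmask p q (pb Z (c k))))).
  apply: eq_bigr => p _; apply: eq_bigr => q _; rewrite linear_sum.
  apply: eq_bigr => k _ /=; rewrite -creav_delta !type_projE pb_creav -colE.
  by rewrite pb_mul mulmxV ?Zframe_unit // pb1 tmask_creav_x.
under eq_bigr do rewrite exchange_big; rewrite exchange_big /=.
apply: eq_bigr => k _; rewrite [in RHS](sum_type_proj (c k)) linear_sum.
apply: eq_bigr => p _; rewrite linear_sum; apply: eq_bigr => q _.
by rewrite pb_creav !colE !mulmxA.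
Qed.

Lemma sum_type_proj_y (c : 'I_(n + n) -> ext) :
  \sum_(p < n.+1) \sum_(q < n.+1)
    type_proj p q.+1 (\sum_k crea k (type_proj p q (c k) : ext)) =
  \sum_k creav (col k antihol_proj) (c k).
Proof.
transitivity (\sum_(p < n.+1) \sum_(q < n.+1) \sum_k
    pb (invmx Z) (creav (Yproj *m col k Z) (tmask p q (pb Z (c k))))).
  apply: eq_bigr => p _; apply: eq_bigr => q _; rewrite linear_sum.
  apply: eq_bigr => k _ /=; rewrite -creav_delta !type_projE pb_creav -colE.
  by rewrite pb_mul mulmxV ?Zframe_unit // pb1 tmask_creav_y.
under eq_bigr do rewrite exchange_big; rewrite exchange_big /=.
apply: eq_bigr => k _; rewrite [in RHS](sum_type_proj (c k)) linear_sum.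
apply: eq_bigr => p _; rewrite linear_sum; apply: eq_bigr => q _.
by rewrite pb_creav !colE !mulmxA.
Qed.

End Types.

From mathcomp Require Import all_classical all_reals all_analysis.
Import numFieldNormedType.Exports.

(** * Derivatives of form-valued functions *)

Section Calculus.
Variables (R : realType) (n : nat).
Local Notation C := (R[i] : fieldType).
Local Notation V := 'rV[R]_(n + n).
Local Notation ext := (ext C (n + n)).
Implicit Types (y v : V) (f g : V -> R[i]) (F : V -> ext).

Definition is_cder y v f (l : R[i]) :=
  is_derive y v (fun z => complex.Re (f z)) (complex.Re l) /\
  is_derive y v (fun z => complex.Im (f z)) (complex.Im l).

Lemma is_cder_cst y v (c : R[i]) : is_cder y v (fun=> c) 0.
Proof. by split; exact: is_derive_cst. Qed.

Lemma is_cderD y v f g l d :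
  is_cder y v f l -> is_cder y v g d -> is_cder y v (fun z => f z + g z) (l + d).
Proof.
move=> [f1 f2] [g1 g2]; split.
  rewrite (_ : (fun z => _) = (fun z => complex.Re (f z)) + (fun z => complex.Re (g z))).
    by rewrite raddfD; exact: is_deriveD.
  by apply/funext => z; rewrite raddfD.
rewrite (_ : (fun z => _) = (fun z => complex.Im (f z)) + (fun z => complex.Im (g z))).
  by rewrite raddfD; exact: is_deriveD.
by apply/funext => z; rewrite raddfD.
Qed.

Lemma is_cderM y v f g l d :
  is_cder y v f l -> is_cder y v g d ->
  is_cder y v (fun z => f z * g z) (l * g y + f y * d).
Proof.
have ReM (a b : R[i]) : complex.Re (a * b) =
   complex.Re a * complex.Re b - complex.Im a * complex.Im b by case: a b => [? ?] [? ?].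
have ImM (a b : R[i]) : complex.Im (a * b) =
   complex.Re a * complex.Im b + complex.Im a * complex.Re b by case: a b => [? ?] [? ?].
have ReD (a b : R[i]) : complex.Re (a + b) = complex.Re a + complex.Re b by case: a b => [? ?] [? ?].
have ImD (a b : R[i]) : complex.Im (a + b) = complex.Im a + complex.Im b by case: a b => [? ?] [? ?].
move=> [f1 f2] [g1 g2]; split.
  rewrite (_ : (fun z => _) = (fun z => complex.Re (f z)) * (fun z => complex.Re (g z))
                           - (fun z => complex.Im (f z)) * (fun z => complex.Im (g z))); last first.
    by apply/funext => z; rewrite ReM.
  apply: is_derive_eq (is_deriveB (is_deriveM f1 g1) (is_deriveM f2 g2)) _.
  by rewrite ReD !ReM /GRing.scale /=; ring.
rewrite (_ : (fun z => _) = (fun z => complex.Re (f z)) * (fun z => complex.Im (g z))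
                         + (fun z => complex.Im (f z)) * (fun z => complex.Re (g z))); last first.
  by apply/funext => z; rewrite ImM.
apply: is_derive_eq (is_deriveD (is_deriveM f1 g2) (is_deriveM f2 g1)) _.
by rewrite ImD !ImM /GRing.scale /=; ring.
Qed.

Lemma is_cder_sum y v (I : Type) (r : seq I) (Q : pred I) (f : I -> V -> R[i])
    (l : I -> R[i]) : (forall i, is_cder y v (f i) (l i)) ->
  is_cder y v (fun z => \sum_(i <- r | Q i) f i z) (\sum_(i <- r | Q i) l i).
Proof.
move=> fl; elim: r => [|i r IH].
  rewrite big_nil (_ : (fun z => _) = fun=> 0); first exact: is_cder_cst.
  by apply/funext => z; rewrite big_nil.
rewrite big_cons; under [X in is_cder _ _ X _]eq_fun do rewrite big_cons.
by case: (Q i) => //; exact: is_cderD.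
Qed.

Lemma is_cder_near y v f g l : (\near y, f y = g y) ->
  is_cder y v f l -> is_cder y v g l.
Proof.
move=> fg [f1 f2]; split.
  by apply: near_eq_is_derive f1; near do congr complex.Re.
by apply: near_eq_is_derive f2; near do congr complex.Im.
Unshelve. all: by end_near. Qed.

Lemma is_cder_real y v (h : V -> R) (l : R) :
  is_derive y v h l -> is_cder y v (fun z => (h z)%:C) l%:C.
Proof. by move=> hl; split => //=; exact: is_derive_cst. Qed.

Lemma derive_C_val y k f l : is_cder y (basis_vec R k) f l -> derive_C k f y = l.
Proof. by move=> [f1 f2]; rewrite /derive_C !derive_val; case: l {f1 f2}. Qed.

Definition is_vder y v F (l : ext) := forall A, is_cder y v (fun z => F z A) (l A).

Lemma is_vder_near y v F (G : V -> ext) l : (\near y, F y = G y) ->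
  is_vder y v F l -> is_vder y v G l.
Proof.
move=> FG Fl A; apply: is_cder_near (Fl A).
by near do congr (fun_of_fin _ A).
Unshelve. all: by end_near. Qed.

Lemma is_vder_cst y v (a : ext) : is_vder y v (fun=> a) 0.
Proof. by move=> A; rewrite ffunE; exact: is_cder_cst. Qed.

Lemma is_vderD y v F (G : V -> ext) l d : is_vder y v F l -> is_vder y v G d ->
  is_vder y v (fun z => F z + G z) (l + d).
Proof.
move=> Fl Gd A; rewrite ffunE; under [X in is_cder _ _ X _]eq_fun do rewrite ffunE.
exact: is_cderD.
Qed.

Lemma is_vderZ y v f F d l : is_cder y v f d -> is_vder y v F l ->
  is_vder y v (fun z => f z *: F z) (d *: F y + f y *: l).
Proof.
move=> fd Fl A; rewrite !ffunE !scale_regE.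
under [X in is_cder _ _ X _]eq_fun do rewrite ffunE scale_regE.
exact: is_cderM.
Qed.

Lemma is_vder_sum y v (I : Type) (r : seq I) (F : I -> V -> ext) (l : I -> ext) :
  (forall i, is_vder y v (F i) (l i)) ->
  is_vder y v (fun z => \sum_(i <- r) F i z) (\sum_(i <- r) l i).
Proof.
move=> Fl A; rewrite sum_ffunE; under [X in is_cder _ _ X _]eq_fun do rewrite sum_ffunE.
by apply: is_cder_sum => i; exact: Fl.
Qed.

Lemma is_vder_linear y v (T : {linear ext -> ext}) F l :
  is_vder y v F l -> is_vder y v (T \o F) (T l).
Proof.
move=> Fl; rewrite (extE l) linear_sum.
rewrite (_ : T \o F = fun z => \sum_A F z A *: T (extb C A)); last first.
  apply/funext => z /=; rewrite [in LHS](extE (F z)) linear_sum.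
  by apply: eq_bigr => A _; rewrite linearZ.
apply: is_vder_sum => A; have := is_vderZ (Fl A) (is_vder_cst y v (T (extb C A))).
by rewrite scaler0 addr0 linearZ.
Qed.

Lemma is_vder_creav y v (x : V -> 'cV[C]_(n + n)) (x' : 'cV[C]_(n + n)) F l :
  (forall j, is_cder y v (fun z => x z j 0) (x' j 0)) -> is_vder y v F l ->
  is_vder y v (fun z => creav (x z) (F z)) (creav x' (F y) + creav (x y) l).
Proof.
move=> xx' Fl; rewrite /creav -big_split; apply: is_vder_sum => j.
by apply: is_vderZ => //; exact: (is_vder_linear (@crea _ _ j)).
Qed.

Lemma is_cder_mulmx y v (M : V -> 'M[C]_(n + n)) (M' : 'M[C]_(n + n)) (x : 'cV[C]_(n + n)) j :
  (forall i k, is_cder y v (fun z => M z i k) (M' i k)) ->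
  is_cder y v (fun z => (M z *m x) j 0) ((M' *m x) j 0).
Proof.
move=> MM'; rewrite mxE; under [X in is_cder _ _ X _]eq_fun do rewrite mxE.
apply: is_cder_sum => k; have := is_cderM (MM' j k) (is_cder_cst y v (x k 0)).
by rewrite mulr0 addr0.
Qed.

Lemma is_vder_lef y v (W : V -> 'M[C]_(n + n)) (W' : 'M[C]_(n + n)) F l :
  (forall i k, is_cder y v (fun z => W z i k) (W' i k)) -> is_vder y v F l ->
  is_vder y v (fun z => lef (W z) (F z)) (lef W' (F y) + lef (W y) l).
Proof.
move=> WW' Fl; rewrite /lef -scalerDr -big_split.
have H0 (l0 : ext) (F0 : V -> ext) : is_vder y v F0 l0 ->
    is_vder y v (fun z => 2%:R^-1 *: F0 z) (2%:R^-1 *: l0).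
  by move=> /(is_vderZ (is_cder_cst y v 2%:R^-1)); rewrite scale0r add0r.
apply: H0; apply: is_vder_sum => k; apply: is_vder_creav => [j|].
  by rewrite mxE; under [X in is_cder _ _ X _]eq_fun do rewrite mxE.
exact: (is_vder_linear (@creav _ _ (delta_mx k 0))).
Qed.

(* [pb (M z)] intertwines creation operators, which determines its derivative. *)
Lemma is_vder_pb_cst y v (M : V -> 'M[C]_(n + n)) (M' H : 'M[C]_(n + n)) (a : ext) :
  (forall i k, is_cder y v (fun z => M z i k) (M' i k)) -> H *m M y = 1%:M ->
  is_vder y v (fun z => pb (M z) a) (rho (M' *m H) (pb (M y) a)).
Proof.
move=> MM' HM; elim/ext_ind: a => [|c a b IHa IHb|x a IH].
- rewrite pb_extone rho_extone; under [X in is_vder _ _ X _]eq_fun do rewrite pb_extone.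
  exact: is_vder_cst.
- under [X in is_vder _ _ X _]eq_fun do rewrite linearP.
  rewrite !linearP; apply: is_vderD => //.
  have := is_vderZ (is_cder_cst y v c) IHa.
  by rewrite scale0r add0r.
- under [X in is_vder _ _ X _]eq_fun do rewrite pb_creav.
  rewrite pb_creav rho_creav -mulmxA [H *m _]mulmxA HM mul1mx.
  by apply: is_vder_creav => // j; exact: is_cder_mulmx.
Qed.

Lemma is_vder_pb y v (M : V -> 'M[C]_(n + n)) (M' H : 'M[C]_(n + n)) F l :
  (forall i k, is_cder y v (fun z => M z i k) (M' i k)) -> H *m M y = 1%:M ->
  is_vder y v F l ->
  is_vder y v (fun z => pb (M z) (F z))
    (rho (M' *m H) (pb (M y) (F y)) + pb (M y) l).
Proof.
move=> MM' HM Fl; rewrite (extE (F y)) (extE l) !linear_sum -big_split /=.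
rewrite (_ : (fun z => _) = fun z => \sum_A F z A *: pb (M z) (extb C A)); last first.
  apply/funext => z /=; rewrite [in LHS](extE (F z)) linear_sum.
  by apply: eq_bigr => A _; rewrite linearZ.
apply: is_vder_sum => A; rewrite !linearZ /= addrC.
by apply: is_vderZ (Fl A) _; exact: is_vder_pb_cst.
Qed.

Lemma is_derive_comp1 y v (h : V -> R) (phi : R -> R) l d :
  is_derive y v h l -> is_derive (h y) 1 phi d -> is_derive y v (phi \o h) (d * l).
Proof.
(* A directional derivative is an ordinary one along t *: v + y, where the one-variable chain rule
   applies. *)
have line (h1 : V -> R) l1 : is_derive y v h1 l1 <->
    is_derive (0 : R) (1 : R) (fun t => h1 (t *: v + y)) l1.
  have E : 'D_v h1 y = 'D_1 (fun t : R => h1 (t *: v + y)) 0.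
    rewrite /derive; set g1 := fun t => t^-1 *: _; set g2 := fun t => t^-1 *: _.
    suff -> : g1 = g2 by [].
    by apply/funext => t; rewrite /g1 /g2 /= addr0 scale0r add0r [_%:A]mulr1.
  split => -[D1 D2]; apply: DeriveDef; rewrite -?D2 ?E //.
    by move/derivable1P: D1.
  by apply/derivable1P.
move=> /line hl phid; apply/line.
have phid' : is_derive (h (0 *: v + y)) 1 phi d by rewrite scale0r add0r.
exact: (@is_derive1_comp _ phi (fun t => h (t *: v + y)) 0 d l phid' hl).
Qed.

End Calculus.

(** * Kaehler metrics in a chart *)

(* Along the segment from the identity to [G] the determinant never vanishes. *)
Lemma posdef_det_gt0 (R : rcfType) m (G : 'M[R]_m) :
  (forall u : 'rV[R]_m, u != 0 -> 0 < (u *m G *m u^T) 0 0) -> 0 < \det G.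
Proof.
move=> Gpos; rewrite ltNge; apply/negP => detG.
pose M : 'M[{poly R}]_m := 1%:M + 'X *: map_mx polyC (G - 1%:M).
have ME t : (\det M).[t] = \det (1%:M + t *: (G - 1%:M)).
  rewrite -horner_evalE -det_map_mx; congr (\det _); apply/matrixP => i j.
  rewrite !mxE /= /horner_eval !hornerE.
  by case: (i == j); rewrite ?hornerE.
have [|t /andP[t0 t1]] := @poly_ivt R (- \det M) 0 1 ler01.
  rewrite !hornerN !ME scale0r addr0 det1 scale1r addrC subrK.
  by rewrite lerN10 oppr_ge0.
rewrite rootN /root ME => /det0P[u u0 uM].
have : (u *m (1%:M + t *: (G - 1%:M)) *m u^T) 0 0 = 0 by rewrite uM mul0mx mxE.
have uu : 0 < (u *m u^T) 0 0.
  have [k uk] : exists k, u 0 k != 0.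
    by apply/existsP; apply: contra_neqT u0 => /existsPn h;
      apply/rowP => k; rewrite mxE; apply/eqP; have := h k; rewrite negbK.
  rewrite mxE (bigD1 k) //= ltr_wpDr //; last by rewrite mxE -expr2 exprn_even_gt0.
  by apply: sumr_ge0 => l _; rewrite mxE -expr2 sqr_ge0.
have uG := Gpos _ u0; set a := (_ *m _) 0 0 in uu; set b := (_ *m _) 0 0 in uG.
have -> : (u *m (1%:M + t *: (G - 1%:M)) *m u^T) 0 0 = (1 - t) * a + t * b.
  rewrite mulmxDr mulmx1 mulmxDl -scalemxAr mulmxBr mulmx1 -scalemxAl mulmxBl.
  rewrite [LHS]mxE [X in _ + X]mxE [X in _ + _ * X]mxE [X in _ + _ * (_ + X)]mxE.
  by rewrite -/a -/b; ring.
apply/eqP; rewrite gt_eqF //.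
move: t0; rewrite le_eqVlt => /predU1P[<-|t0]; first by rewrite subr0 mul1r mul0r addr0.
by rewrite ltr_wpDl ?mulr_gt0 // mulr_ge0 ?subr_ge0 // ltW.
Qed.

Section KahlerPoint.
Variables (R : realType) (n : nat) (X : complex_manifold R n).
Variables (g : metric_field X) (hg : kahler_metric g) (i : mindex X).
Local Notation C := (R[i] : fieldType).
Local Notation V := 'rV[R]_(n + n).
Local Notation ext := (ext C (n + n)).
Local Notation cplx := (map_mx (real_complex R)).
Local Notation J := (cplx (Jmx R n)).
Local Notation U := (mimg i).

Lemma Jmx_tr : (Jmx R n)^T = - Jmx R n.
Proof.
by rewrite /Jmx tr_block_mx !trmx0 linearN /= trmx1 opp_block_mx oppr0 opprK.
Qed.

Lemma Jmx_sqr : Jmx R n *m Jmx R n = - 1%:M.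
Proof.
rewrite /Jmx mulmx_block !(mul0mx, mulmx0, mul1mx, mulmx1, add0r, addr0, mulNmx, mulmxN).
by rewrite scalar_mx_block opp_block_mx oppr0.
Qed.

Lemma gprod_basis (G : 'M[R]_(n + n)) a b :
  gprod G (basis_vec R a) (basis_vec R b) = G a b.
Proof. by rewrite /gprod /basis_vec trmx_delta -rowE -colE !mxE. Qed.

Lemma metric_sym z : U z -> (g i z)^T = g i z.
Proof.
case: hg => -[[_ gs _ _] _] _ Uz; apply/matrixP => a b.
by rewrite mxE -gprod_basis gs // gprod_basis.
Qed.

Lemma metric_det_gt0 z : U z -> 0 < \det (g i z).
Proof. by case: hg => -[[_ _ gp _] _] _ Uz; apply: posdef_det_gt0 => u; exact: gp. Qed.

Lemma metric_J z : U z -> Jmx R n *m g i z = g i z *m Jmx R n.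
Proof.
case: hg => -[_ gJ] _ Uz.
have JGJ : Jmx R n *m g i z *m (Jmx R n)^T = g i z.
  apply/matrixP => a b; rewrite -gprod_basis -[RHS]gprod_basis -(gJ _ _ Uz).
  by rewrite /gprod trmx_mul !mulmxA.
by rewrite -[in RHS]JGJ Jmx_tr mulmxN mulNmx -[_ *m Jmx R n *m Jmx R n]mulmxA
  Jmx_sqr mulmxN mulmx1 opprK.
Qed.

Lemma metric_JG_anti z : U z -> (Jmx R n *m g i z)^T = - (Jmx R n *m g i z).
Proof. by move=> Uz; rewrite trmx_mul metric_sym // Jmx_tr mulmxN metric_J. Qed.

Lemma img_near z : U z -> (\near z, U z).
Proof. by move=> Uz; apply: open_nbhs_nbhs; split => //; exact: mimg_open. Qed.

End KahlerPoint.

(** * Covariant derivatives *)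

Section Nabla.
Variables (R : realType) (n : nat) (X : complex_manifold R n).
Variables (g : metric_field X) (hg : kahler_metric g) (i : mindex X).
Local Notation C := (R[i] : fieldType).
Local Notation V := 'rV[R]_(n + n).
Local Notation ext := (ext C (n + n)).
Local Notation extone := (extb C (@finset.set0 'I_(n + n))).
Local Notation cplx := (map_mx (real_complex R)).
Local Notation J := (cplx (Jmx R n)).
Local Notation U := (mimg i).
Variables (y : V) (Uy : U y).

Local Notation Gc z := (cplx (g i z)).
Local Notation G := (Gc y).
Local Notation H := (invmx G).
Local Notation W z := (cplx (Jmx R n *m g i z)).
Local Notation ev k := (basis_vec R k).

Definition metric_deriv k : 'M[C]_(n + n) :=
  \matrix_(a, b) ('D_(ev k) (fun z => g i z a b) y)%:C.
Local Notation T := metric_deriv.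

Lemma two_neq0 : 2%:R != 0 :> C. Proof. by rewrite pnatr_eq0. Qed.

Lemma is_cder_unique f v (l l' : R[i]) : is_cder y v f l -> is_cder y v f l' -> l = l'.
Proof.
case: l l' => [a b] [c d] [[_ fa] [_ fb]] [[_ fc] [_ fd]].
by move: fa fb; rewrite fc fd /= => -> ->.
Qed.

Lemma is_cder_metric k a b : is_cder y (ev k) (fun z => Gc z a b) (T k a b).
Proof.
rewrite mxE; under [X in is_cder _ _ X _]eq_fun do rewrite mxE.
apply: is_cder_real; apply: derivableP; apply: diff_derivable.
(* The empty list of directions gives the differentiability of the entry itself. *)
by case: hg => -[[gs _ _ _] _] _; exact: (gs i a b [::] y Uy).
Qed.

Lemma Jmx_tr_C : J^T = - J.
Proof. by rewrite map_trmx Jmx_tr map_mxN. Qed.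

Lemma Jmx_sqr_C : J *m J = - 1%:M.
Proof. by rewrite -map_mxM Jmx_sqr map_mxN map_mx1. Qed.

Lemma metric_sym_C z : U z -> (Gc z)^T = Gc z.
Proof. by move=> Uz; rewrite map_trmx (metric_sym hg). Qed.

Lemma metric_mulV z : U z -> Gc z *m invmx (Gc z) = 1%:M.
Proof.
move=> Uz; apply: mulmxV; rewrite unitmxE det_map_mx unitfE fmorph_eq0 gt_eqF //.
exact: (metric_det_gt0 hg).
Qed.

Let G_unit : G *m H = 1%:M := metric_mulV Uy.

Lemma metric_J_C z : U z -> J *m Gc z = Gc z *m J.
Proof. by move=> Uz; rewrite -!map_mxM (metric_J hg). Qed.

Lemma metric_deriv_tr k : (T k)^T = T k.
Proof.
apply/matrixP => a b; rewrite mxE; apply: (is_cder_unique (is_cder_metric k b a)).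
apply: is_cder_near (is_cder_metric k a b); near=> z.
have Uz : U z by near: z; exact: img_near.
by rewrite -{1}(metric_sym_C Uz) mxE.
Unshelve. all: by end_near. Qed.

Lemma is_cder_JG k a b : is_cder y (ev k) (fun z => W z a b) ((J *m T k) a b).
Proof.
under [X in is_cder _ _ X _]eq_fun do rewrite map_mxM mxE.
rewrite mxE; apply: is_cder_sum => l.
have := is_cderM (is_cder_cst y (ev k) (J a l)) (is_cder_metric k l b).
by rewrite mul0r add0r.
Qed.

Lemma metric_deriv_J k : J *m T k = T k *m J.
Proof.
apply/matrixP => a b; apply: (is_cder_unique (is_cder_JG k a b)).
have GJ : is_cder y (ev k) (fun z => (Gc z *m J) a b) ((T k *m J) a b).
  rewrite mxE; under [X in is_cder _ _ X _]eq_fun do rewrite mxE.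
  apply: is_cder_sum => l.
  have := is_cderM (is_cder_metric k a l) (is_cder_cst y (ev k) (J l b)).
  by rewrite mulr0 addr0.
apply: is_cder_near GJ; near=> z.
have Uz : U z by near: z; exact: img_near.
by rewrite map_mxM metric_J_C.
Unshelve. all: by end_near. Qed.

Lemma ext_d_vder (F : V -> ext) (F' : 'I_(n + n) -> ext) :
  (forall k, is_vder y (ev k) F (F' k)) -> ext_d F y = \sum_k crea k (F' k).
Proof.
move=> FF'; apply: eq_bigr => k _; rewrite wedge_dx; congr (crea k _).
by apply/ffunP => A; rewrite ffunE; exact: derive_C_val (FF' k A).
Qed.

Lemma wedge_extoner (a : ext) : wedge a extone = a.
Proof.
apply/ffunP => A; rewrite ffunE (bigD1 A) ?fintype.subxx //= finset.setDv big1 ?addr0.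
  rewrite [extone _]ffunE eqxx mulr1 shuffle_signE shsE big1 ?mul1r // => k _.
  by rewrite sgnE finset.big_set0.
move=> B /andP[sBA BA]; rewrite ffunE finset.setD_eq0 (_ : _ \subset _ = false) ?mulr0 //.
by apply: contraNF BA => sAB; rewrite finset.eqEsubset sBA.
Qed.

Lemma metric_deriv_closed a b c :
  (J *m T a) b c + (J *m T b) c a + (J *m T c) a b = 0.
Proof.
apply: (@cyclic_closed _ _ two_neq0 (fun k => J *m T k)) => [k|].
  by rewrite trmx_mul Jmx_tr_C metric_deriv_tr mulmxN metric_deriv_J.
(* Written as omega /\ 1, omega becomes a value of [lef], whose derivative is known. *)
have vd k : is_vder y (ev k) (fun z => fundamental_form (g i z)) (lef (J *m T k) extone).
  have := is_vder_lef (fun a b => is_cder_JG k a b) (is_vder_cst y (ev k) extone).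
  rewrite linear0 addr0; apply: is_vder_near; near=> z.
  have Uz : U z by near: z; exact: img_near.
  by rewrite -wedge_fundamental ?wedge_extoner //; exact: (metric_JG_anti hg).
case: hg => _ /(_ i y Uy) dom; transitivity (ext_d (fun z => fundamental_form (g i z)) y).
  by rewrite (ext_d_vder vd); apply: eq_bigr => k _; rewrite creav_delta.
exact: dom.
Unshelve. all: by end_near. Qed.

Local Notation Gam := (levi_civita H T).

Lemma conn_metric k : Gam k *m G + G *m (Gam k)^T = T k.
Proof. by apply: (levi_civita_metric two_neq0 (metric_sym_C Uy) G_unit metric_deriv_tr). Qed.

Lemma conn_J k : Gam k *m J = J *m Gam k.
Proof.
exact: (levi_civita_J G_unit Jmx_tr_C Jmx_sqr_C (metric_J_C Uy) metric_deriv_tr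
  metric_deriv_J metric_deriv_closed).
Qed.

Lemma conn_torsion (a : ext) : \sum_k crea k (rho (Gam k) a) = 0.
Proof.
by apply: (torsion_free two_neq0) => k p q; exact: (levi_civita_sym _ metric_deriv_tr).
Qed.

(* [N k] is the covariant derivative at [y] of the form with expression [F]. *)
Definition has_nabla (F : V -> ext) (N : 'I_(n + n) -> ext) :=
  forall k, is_vder y (ev k) F (N k + rho (Gam k) (F y)).

Lemma nabla_near (F E : V -> ext) N : (forall z, U z -> F z = E z) ->
  has_nabla F N -> has_nabla E N.
Proof.
move=> FE FN k; rewrite -(FE _ Uy); apply: is_vder_near (FN k).
by near=> z; apply: FE; near: z; exact: img_near.
Unshelve. all: by end_near. Qed.

Lemma nabla_parity F N : has_nabla F N ->
  has_nabla (fun z => parity (F z)) (fun k => parity (N k)).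
Proof.
move=> FN k; rewrite -parity_rho -linearD.
exact: (is_vder_linear (@parity C (n + n)) (FN k)).
Qed.

Lemma nabla_lef F N : has_nabla F N ->
  has_nabla (fun z => lef (W z) (F z)) (fun k => lef (W y) (N k)).
Proof.
move=> FN k.
have WT : Gam k *m W y + W y *m (Gam k)^T = J *m T k.
  rewrite map_mxM /= mulmxA conn_J -[J *m Gam k *m G]mulmxA -[J *m G *m _]mulmxA.
  by rewrite -mulmxDr conn_metric.
have E : lef (J *m T k) (F y) + lef (W y) (N k + rho (Gam k) (F y)) =
    lef (W y) (N k) + rho (Gam k) (lef (W y) (F y)).
  by rewrite rho_lef WT linearD; exact: addrCA.
rewrite -E; exact: is_vder_lef (fun a b => is_cder_JG k a b) (FN k).
Qed.

Lemma nabla_wedge F N : has_nabla F N ->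
  has_nabla (fun z => wedge (fundamental_form (g i z)) (F z)) (fun k => lef (W y) (N k)).
Proof.
move=> /nabla_lef; apply: nabla_near => z Uz.
by rewrite wedge_fundamental //; exact: (metric_JG_anti hg).
Qed.

Variable s : nat.
Local Notation u z := ((-1) ^+ s * ((Num.sqrt (\det (g i z)))^-1)%:C : C).

Lemma star_factor_sqr z : U z -> u z ^+ 2 * \det (Gc z) = 1.
Proof.
move=> Uz; rewrite exprMn sqrr_sign mul1r det_map_mx -rmorphXn -rmorphM /=.
have dpos := metric_det_gt0 hg Uz.
by rewrite exprVn sqr_sqrtr ?ltW // mulVf ?gt_eqF // rmorph1.
Qed.

Lemma tr_metric_deriv k : \tr (T k *m H) = 2%:R * \tr (Gam k).
Proof.
rewrite -(conn_metric k) mulmxDl -mulmxA G_unit mulmx1 mxtraceD.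
rewrite [\tr (G *m _ *m _)]mxtrace_mulC mulmxA (mulmx1C G_unit) mul1mx mxtrace_tr.
by rewrite mulr_natl mulr2n.
Qed.

(** Jacobi's formula: the derivative of the pull-back by G, read on the top form, where [pb] acts by
    the determinant and [rho] by the trace. *)
Lemma is_cder_det k :
  is_cder y (ev k) (fun z => (\det (g i z))%:C) (\tr (T k *m H) * (\det (g i y))%:C).
Proof.
have := is_vder_pb_cst (extb C [set: 'I_(n + n)]%SET) (is_cder_metric k) (mulmx1C G_unit).
move=> /(_ [set: 'I_(n + n)]%SET).
rewrite pb_exttop linearZ /= rho_exttop scalerA !ffunE eqxx scale_regE mulr1.
rewrite mulrC det_map_mx; under eq_fun do
  rewrite pb_exttop ffunE ffunE eqxx scale_regE mulr1 det_map_mx.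
by [].
Qed.

Lemma is_derive_sqrtV (x : R) : 0 < x ->
  is_derive x 1 (fun t => (Num.sqrt t)^-1) (- (x^-1 * (2 * Num.sqrt x)^-1)).
Proof.
move=> x0; have [d1 d2] := is_derive1_sqrt x0.
have s0 : Num.sqrt x != 0 by rewrite sqrtr_eq0 -ltNge.
apply: DeriveDef; first exact: derivableV.
rewrite deriveV // d2 sqr_sqrtr ?(ltW x0) //.
by rewrite scaleNr.
Qed.

(** The factor is a constant sign times (det G)^(-1/2), so its logarithmic derivative is half of -
    tr (T k H), and [tr_metric_deriv] applies. *)
Lemma is_cder_star_factor k : is_cder y (ev k) (fun z => u z) (- (\tr (Gam k) * u y)).
Proof.
have dpos := metric_det_gt0 hg Uy.
set dt := \det (g i y) in dpos.
have dC := is_cder_det k.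
set d := complex.Re (\tr (T k *m H) * dt%:C).
have dd : is_derive y (ev k) (fun z => \det (g i z)) d by case: dC.
have dE : d%:C = \tr (T k *m H) * dt%:C := is_cder_unique (is_cder_real dd) dC.
have du := is_cder_real (is_derive_comp1 dd (is_derive_sqrtV dpos)).
have := is_cderM (is_cder_cst y (ev k) ((-1) ^+ s)) du.
rewrite mul0r add0r; congr is_cder.
rewrite mulNr rmorphN mulrN; congr (- _).
rewrite mulrCA; congr (_ * _).
have dtC : dt%:C != 0 :> C by rewrite fmorph_eq0 gt_eqF.
rewrite [in LHS]rmorphM /= dE tr_metric_deriv -/dt.
rewrite !(rmorphM, fmorphV) /= rmorph_nat.
have sC : (Num.sqrt dt)%:C != 0 :> C by rewrite fmorph_eq0 sqrtr_eq0 -ltNge.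
move: (dt%:C) ((Num.sqrt dt)%:C) (\tr _) dtC sC => d0 s0 t d0N s0N.
by field; rewrite d0N s0N.
Qed.

(** The derivative of the factor contributes - tr Gam, that of [pb G] contributes T k H = Gam + G
    Gam^T H, and [fstar] turns Gam into tr Gam - Gam^T. The traces cancel; [pb G] carries Gam^T to G
    Gam^T H, which cancels too, and only [rho] of Gam is left. *)
Lemma nabla_hstar F N : has_nabla F N ->
  has_nabla (fun z => hstar (Gc z) (u z) (F z)) (fun k => hstar G (u y) (N k)).
Proof.
move=> FN k.
have SN : is_vder y (ev k) (fun z => fstar (F z)) (fstar (N k + rho (Gam k) (F y))).
  exact: (is_vder_linear (@fstar C (n + n)) (FN k)).
have := is_vderZ (is_cder_star_factor k)
  (is_vder_pb (is_cder_metric k) (mulmx1C G_unit) SN).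
congr is_vder.
have TG : T k *m H = Gam k + G *m (Gam k)^T *m H.
  by rewrite -[in LHS](conn_metric k) mulmxDl -[Gam k *m G *m H]mulmxA G_unit mulmx1.
have PG : G *m (Gam k)^T = (G *m (Gam k)^T *m H) *m G.
  by rewrite -[RHS]mulmxA (mulmx1C G_unit) mulmx1.
have SD : pb G (fstar (N k + rho (Gam k) (F y))) = pb G (fstar (N k)) +
    (\tr (Gam k) *: pb G (fstar (F y)) - pb G (rho (Gam k)^T (fstar (F y)))).
  rewrite (linearD (@fstar _ _)) /= fstar_rho (linearD (pb G)) /=.
  by rewrite (linearB (pb G)) /= (linearZ_LR (pb G)).
have RP : rho (T k *m H) (pb G (fstar (F y))) =
    rho (Gam k) (pb G (fstar (F y))) + pb G (rho (Gam k)^T (fstar (F y))).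
  by rewrite TG rhoDl (pb_rho _ PG).
rewrite SD RP /hstar (linearZ_LR (rho (Gam k))) /=.
move: (pb G (fstar (F y))) (pb G (rho _ _)) (pb G (fstar (N k))) (u y) (\tr _).
move=> p b e w t; rewrite -addrA [b + _]addrC -!addrA addNr addr0.
rewrite !scalerDr scalerA scaleNr [t * w]mulrC addrC -!addrA addrN addr0 addrC.
by [].
Qed.

(** The conclusion of [star_hstar] for a fixed s, which is only known to exist. *)
Hypothesis starE : forall (G0 : 'M[R]_(n + n)) (b : ext), G0^T = G0 -> 0 < \det G0 ->
  star G0 b = hstar (cplx G0) ((-1) ^+ s * ((Num.sqrt (\det G0))^-1)%:C) b.

Lemma two_n_even : ~~ odd (n + n).
Proof. by rewrite addnn odd_double. Qed.

Lemma star_metricE z (b : ext) : U z -> star (g i z) b = hstar (Gc z) (u z) b.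
Proof. by move=> Uz; apply: starE; [exact: (metric_sym hg)|exact: (metric_det_gt0 hg)]. Qed.

(** [xget] returns some preimage: [hstarK] provides one, so the default 0 is not taken, and
    [hstar_inj] makes it unique. *)
Lemma star_inv_metricE z (b : ext) : U z ->
  star_inv (g i z) b = hstar (Gc z) (u z) (parity b).
Proof.
move=> Uz.
have hK := hstarK two_n_even (metric_sym_C Uz) (metric_mulV Uz) (star_factor_sqr Uz).
have hI := hstar_inj two_n_even (metric_sym_C Uz) (metric_mulV Uz) (star_factor_sqr Uz).
have e : star (g i z) (hstar (Gc z) (u z) (parity b)) = b.
  by rewrite star_metricE // hK parityK.
apply: hI; rewrite -[LHS]star_metricE // hK parityK.
by rewrite /star_inv; case: xgetP => [c _ ->|/(_ _ e)].
Qed.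

Lemma wedge_metricE z (b : ext) : U z ->
  wedge (fundamental_form (g i z)) b = lef (W z) b.
Proof. by move=> Uz; apply: wedge_fundamental; exact: (metric_JG_anti hg). Qed.

Lemma nabla_hodge (a : Defs.form X) N : has_nabla (a i) N ->
  has_nabla (hodge g a i) (fun k => hstar G (u y) (N k)).
Proof. by move=> /nabla_hstar; apply: nabla_near => z Uz; rewrite -star_metricE. Qed.

Lemma nabla_Lefschetz (a : Defs.form X) N : has_nabla (a i) N ->
  has_nabla (Lefschetz g a i) (fun k => lef (W y) (N k)).
Proof. exact: nabla_wedge. Qed.

Lemma LambdaE (a : Defs.form X) z : U z -> Lambda g a i z = lam (Gc z) (W z) (u z) (a i z).
Proof.
move=> Uz; transitivity
  (star_inv (g i z) (wedge (fundamental_form (g i z)) (star (g i z) (a i z)))) => //.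
by rewrite (star_inv_metricE _ Uz) (wedge_metricE _ Uz) (star_metricE _ Uz).
Qed.

Lemma nabla_Lambda (a : Defs.form X) N : has_nabla (a i) N ->
  has_nabla (Lambda g a i) (fun k => lam G (W y) (u y) (N k)).
Proof.
move=> aN; have := nabla_hstar (nabla_parity (nabla_lef (nabla_hstar aN))).
by apply: nabla_near => z Uz; rewrite LambdaE.
Qed.

Lemma nabla_type_proj (F : V -> ext) N p q : has_nabla F N ->
  has_nabla (fun z => type_proj p q (F z) : ext) (fun k => type_proj p q (N k) : ext).
Proof.
move=> FN k; rewrite -(type_proj_rho _ _ _ (conn_J k)).
have := is_vder_linear (type_proj p q : {linear ext -> ext}) (FN k).
by rewrite (linearD (type_proj p q : {linear ext -> ext})).
Qed.

Lemma nabla_d (F : V -> ext) N : has_nabla F N -> ext_d F y = \sum_k crea k (N k).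
Proof.
move=> FN; rewrite (ext_d_vder FN).
under eq_bigr do rewrite linearD /=.
by rewrite big_split /= conn_torsion addr0.
Qed.

Lemma nabla_del (a : Defs.form X) N : has_nabla (a i) N ->
  del a i y = symb (hol_proj R n) N.
Proof.
move=> aN; rewrite /symb -sum_type_proj_x; apply: eq_bigr => p _; apply: eq_bigr => q _.
by rewrite /type_op /d_op (nabla_d (nabla_type_proj p q aN)).
Qed.

Lemma nabla_delbar (a : Defs.form X) N : has_nabla (a i) N ->
  delbar a i y = symb (antihol_proj R n) N.
Proof.
move=> aN; rewrite /symb -sum_type_proj_y; apply: eq_bigr => p _; apply: eq_bigr => q _.
by rewrite /type_op /d_op (nabla_d (nabla_type_proj p q aN)).
Qed.

Lemma smooth_nabla (a : Defs.form X) : smooth_form a -> exists N, has_nabla (a i) N.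
Proof.
move=> [sa _].
pose F' k : ext := [ffun A : {set 'I_(n + n)} => derive_C k (fun z => a i z A) y].
exists (fun k => F' k - rho (Gam k) (a i y)) => k; rewrite subrK => A.
rewrite ffunE; have [sR sI] := sa i A.
split; apply: derivableP; apply: diff_derivable.
  exact: (sR [::] y Uy).
exact: (sI [::] y Uy).
Qed.

Lemma del_adjE (a : Defs.form X) N : has_nabla (a i) N ->
  del_adj g a i y =
  - hstar G (u y) (symb (antihol_proj R n) (fun k => hstar G (u y) (N k))).
Proof.
move=> /nabla_hodge/nabla_delbar e.
rewrite /del_adj /scale_op scalecvE scaleN1r; congr (- _).
by rewrite [LHS](star_metricE _ Uy) e.
Qed.

Lemma delbar_adjE (a : Defs.form X) N : has_nabla (a i) N ->
  delbar_adj g a i y =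
  - hstar G (u y) (symb (hol_proj R n) (fun k => hstar G (u y) (N k))).
Proof.
move=> /nabla_hodge/nabla_del e.
rewrite /delbar_adj /scale_op scalecvE scaleN1r; congr (- _).
by rewrite [LHS](star_metricE _ Uy) e.
Qed.

Lemma LefschetzE (a : Defs.form X) : Lefschetz g a i y = lef (W y) (a i y).
Proof. exact: wedge_metricE. Qed.

Lemma JG_invG : W y *m H = J.
Proof. by rewrite map_mxM /= -mulmxA G_unit mulmx1. Qed.

Lemma JG_invG_hol : W y *m H *m hol_proj R n = 'i%C *: hol_proj R n.
Proof. by rewrite JG_invG J_hol_proj. Qed.

Lemma JG_invG_antihol : W y *m H *m antihol_proj R n = - 'i%C *: antihol_proj R n.
Proof. by rewrite JG_invG J_antihol_proj. Qed.

Let W_anti : (W y)^T = - W y.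
Proof. by rewrite map_trmx (metric_JG_anti hg) // map_mxN. Qed.

Let lamS := lam_symb two_neq0 two_n_even (metric_sym_C Uy) G_unit (star_factor_sqr Uy) W_anti.
Let lefS := lef_hstar_symb two_neq0 two_n_even (metric_sym_C Uy) G_unit (star_factor_sqr Uy) W_anti.
Let lamhS := lam_hstar_symb (W y) two_n_even (metric_sym_C Uy) G_unit (star_factor_sqr Uy).

Lemma kahler_identities_at (a : Defs.form X) : smooth_form a ->
  [/\ commutator (Lefschetz g) (del (X := X)) a i y = 0,
      commutator (Lefschetz g) (delbar (X := X)) a i y = 0,
      commutator (Lambda g) (del_adj g) a i y = 0 &
      commutator (Lambda g) (delbar_adj g) a i y = 0] /\
  (commutator (Lambda g) (delbar (X := X)) a i y =
     scale_op (- 'i%C) (del_adj g) a i y /\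
   commutator (Lambda g) (del (X := X)) a i y =
     scale_op 'i%C (delbar_adj g) a i y) /\
  (commutator (delbar_adj g) (Lefschetz g) a i y =
     scale_op 'i%C (del (X := X)) a i y /\
   commutator (del_adj g) (Lefschetz g) a i y =
     scale_op (- 'i%C) (delbar (X := X)) a i y).
Proof.
move=> /smooth_nabla[N aN].
have aL := nabla_Lefschetz aN; have aLam := nabla_Lambda aN.
rewrite /commutator /scale_op; split; first split.
- by rewrite LefschetzE (nabla_del aN) (nabla_del aL) lef_symb subrr.
- by rewrite LefschetzE (nabla_delbar aN) (nabla_delbar aL) lef_symb subrr.
- rewrite (LambdaE _ Uy) (del_adjE aN) (del_adjE aLam) linearN /=.
  by rewrite lamhS subrr.
- rewrite (LambdaE _ Uy) (delbar_adjE aN) (delbar_adjE aLam) linearN /=.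
  by rewrite lamhS subrr.
split; split; rewrite scalecvE.
(* The terms in [lam (N k)] cancel; what remains is the eigenvalue term, in which [del_adjE]
   recognizes the adjoint. *)
- rewrite (LambdaE _ Uy) (nabla_delbar aN) (nabla_delbar aLam) (lamS JG_invG_antihol).
  by rewrite (del_adjE aN) addrAC subrr add0r scalerN.
- rewrite (LambdaE _ Uy) (nabla_del aN) (nabla_del aLam) (lamS JG_invG_hol).
  by rewrite (delbar_adjE aN) addrAC subrr add0r scalerN.
- rewrite LefschetzE (delbar_adjE aL) (delbar_adjE aN) (nabla_del aN).
  by rewrite linearN /= opprK (lefS JG_invG_hol) addrA addNr add0r.
- rewrite LefschetzE (del_adjE aL) (del_adjE aN) (nabla_delbar aN).
  by rewrite linearN /= opprK (lefS JG_invG_antihol) addrA addNr add0r.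
Qed.

End Nabla.

Local Close Scope complex_scope.

Theorem mainTheorem2 (R : realType) (n : nat) (X : complex_manifold R n)
    (g : metric_field X) (hg : kahler_metric g) :
  [/\ op_eq (commutator (Lefschetz g) (del (X := X))) (zero_op (X := X)),
      op_eq (commutator (Lefschetz g) (delbar (X := X))) (zero_op (X := X)),
      op_eq (commutator (Lambda g) (del_adj g)) (zero_op (X := X)) &
      op_eq (commutator (Lambda g) (delbar_adj g)) (zero_op (X := X))] /\
  (op_eq (commutator (Lambda g) (delbar (X := X)))
         (scale_op (- 'i%C) (del_adj g)) /\
   op_eq (commutator (Lambda g) (del (X := X)))
         (scale_op 'i%C (delbar_adj g))) /\
  (op_eq (commutator (delbar_adj g) (Lefschetz g))
         (scale_op 'i%C (del (X := X))) /\
   op_eq (commutator (del_adj g) (Lefschetz g))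
         (scale_op (- 'i%C) (delbar (X := X)))).
Proof.
(* This s depends on n alone, hence it is chosen before the chart and the point. *)
have [s starE] := star_hstar R n.
have K := kahler_identities_at hg _ starE.
split; first by split=> a [sa _] i y Uy; case: (K i y Uy a sa) => -[].
by split; split=> a [sa _] i y Uy; case: (K i y Uy a sa) => _ [[? ?] [? ?]].
Qed.
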